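(* Let $r\geq3$, and let $G$ be an $n$-vertex $K_r$-minor free graph with maximum spread among all $n$-vertex $K_r$-minor free graphs. If $n$ is sufficiently large, then there is a set $L\subseteq V(G)$ with $|L|=r-2$ such that $G=G[L]\vee(n-r+2)K_1$, i.e. every vertex of $L$ is adjacent to every vertex of $V(G)\setminus L$ and $V(G)\setminus L$ is an independent set (and $G[L]\subseteq K_{r-2}$).
   Context: Spread is $\lambda_1(G)-\lambda_n(G)$, the difference of the largest and smallest adjacency eigenvalues. $G[L]$ is the induced subgraph, $\vee$ denotes the join, $(n-r+2)K_1$ is an edgeless graph on $n-r+2$ vertices. *)

(* Defs.v *)
From mathcomp Require Import all_boot all_order all_algebra.
From mathcomp Require Import reals.
Set Implicit Arguments. Unset Strict Implicit. Unset Printing Implicit Defensive.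
Import Order.TTheory GRing.Theory Num.Theory.
Local Open Scope ring_scope.

Definition simple_graph (n : nat) (e : rel 'I_n) : Prop :=
  symmetric e /\ irreflexive e.

Definition connected_in (n : nat) (e : rel 'I_n) (B : {set 'I_n}) : Prop :=
  forall x y, x \in B -> y \in B ->
    connect [rel u v | [&& e u v, u \in B & v \in B]] x y.

Definition has_K_minor (r n : nat) (e : rel 'I_n) : Prop :=
  exists B : 'I_r -> {set 'I_n},
    [/\ forall i, B i != set0,
        forall i, connected_in e (B i),
        forall i j, i != j -> [disjoint B i & B j] &
        forall i j, i != j -> exists x y, [/\ x \in B i, y \in B j & e x y]].

Definition adjmx (R : realType) (n : nat) (e : rel 'I_n) : 'M[R]_n :=
  \matrix_(i, j) (e i j)%:R.

Definition is_spread (R : realType) (n : nat) (A : 'M[R]_n) (s : R) : Prop :=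
  (exists a b, [/\ eigenvalue A a, eigenvalue A b & s = a - b]) /\
  (forall a b, eigenvalue A a -> eigenvalue A b -> a - b <= s).

Definition max_spread_minor_free (R : realType) (r n : nat) (e : rel 'I_n) : Prop :=
  forall e' : rel 'I_n, simple_graph e' -> ~ has_K_minor r e' ->
    forall s s' : R, is_spread (adjmx R e) s -> is_spread (adjmx R e') s' -> s' <= s.

(* Main.v *)
Require Import Defs.
From mathcomp Require Import all_classical all_reals topology normedtype derive.
From mathcomp Require Import all_boot all_order all_algebra zify ring lra.
Import Order.TTheory GRing.Theory Num.Theory.
Import numFieldNormedType.Exports.
Set Implicit Arguments. Unset Strict Implicit. Unset Printing Implicit Defensive.
Local Open Scope ring_scope.

(** Put [k = r - 2].  Since [K_{k,n-k}] has no [K_{k+2}] minor, the extremal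
    spread is at least [2 sqrt (k (n - k))].  A [K_{k+2}]-minor-free graph is
    [2^(k+2)]-degenerate, and no [k + 1] of its vertices have [k + 3] common
    neighbours.  Hence, up to [o(sqrt n)], both extreme eigenvalues come from the
    edges between the boundedly many vertices of linear degree and the rest, and
    their squares are at most the largest degree sum of [k] such vertices with a
    common neighbour.  So some [k] vertices, the hubs [L], are adjacent to all but
    [m = o(n)] vertices.

    Outside [L] every edge meets one of the [m] vertices not joined to [L], each of
    which has at most one neighbour joined to [L]; so the graph there lives on at
    most [2 m] vertices and has spectral radius [o(sqrt n)].  For a unit
    eigenvector of either extreme eigenvalue the entries on [L] are almost equal.
    Keeping them, making the vector constant outside [L], deleting the edges
    outside [L] and adding all edges to [L] gains order [m / sqrt n] in the
    quadratic form, by Cauchy-Schwarz, and loses only [o(m / sqrt n)].  Maximality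
    of the spread therefore forces [m = 0]. *)

(** * Minors *)

Section Packings.
Local Open Scope nat_scope.
Variables (n : nat) (e : rel 'I_n).
Hypothesis e_sym : symmetric e.
Local Notation T := 'I_n.
Implicit Types (X Y Z B : {set T}) (P Q : {set {set T}}).

Definition touch X Y := [exists x in X, exists y in Y, e x y].

Lemma touchP X Y :
  reflect (exists x y, [/\ x \in X, y \in Y & e x y]) (touch X Y).
Proof.
apply: (iffP idP) => [/exists_inP[x xX /exists_inP[y yY exy]]|].
  by exists x, y.
by move=> [x [y [xX yY exy]]]; apply/exists_inP; exists x => //; apply/exists_inP; exists y.
Qed.

Lemma touchC X Y : touch X Y = touch Y X.
Proof.
by apply/touchP/touchP => -[x [y [xX yY exy]]]; exists y, x; rewrite e_sym.
Qed.

Lemma touchUl X Y Z : touch (X :|: Y) Z = touch X Z || touch Y Z.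
Proof.
apply/touchP/orP => [[x [y [/setUP[xX|xY] yZ exy]]]|[]/touchP[x [y [xX yZ exy]]]].
- by left; apply/touchP; exists x, y.
- by right; apply/touchP; exists x, y.
- by exists x, y; rewrite inE xX.
- by exists x, y; rewrite inE xX orbT.
Qed.

Lemma touchS X Y X' Y' : X \subset X' -> Y \subset Y' -> touch X Y -> touch X' Y'.
Proof.
move=> sX sY /touchP[x [y [xX yY exy]]]; apply/touchP; exists x, y.
by rewrite (subsetP sX) // (subsetP sY).
Qed.

Lemma connected1 x : connected_in e [set x].
Proof. by move=> y z /set1P-> /set1P->; exact: connect0. Qed.

Lemma connected_in_mono B B' x y : B \subset B' ->
  connect [rel u v | [&& e u v, u \in B & v \in B]] x y ->
  connect [rel u v | [&& e u v, u \in B' & v \in B']] x y.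
Proof.
move=> sB; apply: connect_sub => u v /and3P[euv uB vB].
by apply: connect1; rewrite /= euv !(subsetP sB).
Qed.

Lemma connectedU X Y : connected_in e X -> connected_in e Y -> touch X Y ->
  connected_in e (X :|: Y).
Proof.
move=> cX cY /touchP[x0 [y0 [x0X y0Y e0]]].
have sXU := subsetUl X Y; have sYU := subsetUr X Y.
have csym : symmetric [rel u v | [&& e u v, u \in X :|: Y & v \in X :|: Y]].
  by move=> u v /=; rewrite e_sym [(v \in _) && _]andbC.
have to_x0 u : u \in X :|: Y ->
    connect [rel u v | [&& e u v, u \in X :|: Y & v \in X :|: Y]] u x0.
  case/setUP=> [uX|uY]; first exact: (connected_in_mono sXU (cX _ _ uX x0X)).
  apply: connect_trans (connected_in_mono sYU (cY _ _ uY y0Y)) _.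
  by apply: connect1; rewrite /= e_sym e0 !inE x0X y0Y orbT.
move=> u v uU vU; apply: connect_trans (to_x0 u uU) _.
by rewrite (sym_connect_sym csym); exact: to_x0.
Qed.

(** The branch sets of a minor, kept as a set of sets so that contracting an edge becomes a union of
    two members. *)
Definition packing P : Prop :=
  [/\ trivIset P, set0 \notin P & forall B, B \in P -> connected_in e B].

Definition nbhd P X := [set Y in P | (Y != X) && touch X Y].

(** Twice the number of edges of the graph with the parts as vertices: every touching pair is
    counted from both sides. *)
Definition arcs P := \sum_(X in P) #|nbhd P X|.

(** Two consequences of being a union of parts of [P]: containing a part transfers touching, and
    lying in the cover transfers disjointness. *)
Definition coarsens Q P : Prop :=
  forall Y, Y \in Q -> (exists2 X, X \in P & X \subset Y) /\ Y \subset cover P.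

Lemma arcs_add P Z : Z \notin P -> arcs (Z |: P) = arcs P + (#|nbhd P Z|).*2.
Proof.
move=> ZP; rewrite /arcs big_setU1 //=.
have -> : nbhd (Z |: P) Z = nbhd P Z.
  apply/setP=> Y; rewrite !inE; case: eqP => //= ->.
  by rewrite (negPf ZP).
have -> : \sum_(X in P) #|nbhd (Z |: P) X| =
    \sum_(X in P) (#|nbhd P X| + touch X Z).
  apply: eq_bigr => X XP; have [t|t] := boolP (touch X Z).
    have -> : nbhd (Z |: P) X = Z |: nbhd P X.
      apply/setP=> Y; rewrite !inE; case: eqP => //= ->; rewrite t andbT.
      by apply: contraNneq ZP => ->.
    by rewrite cardsU1 !inE (negPf ZP) /= addnC.
  rewrite addn0; apply: eq_card => Y; rewrite !inE; case: eqP => //= ->.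
  by rewrite (negPf t) !andbF.
rewrite big_split /=.
suff -> : \sum_(X in P) touch X Z = #|nbhd P Z| by rewrite addnCA addnn.
rewrite -big_mkcondr /= sum1_card; apply: eq_card => Y; rewrite !inE.
rewrite unfold_in touchC; case: eqP => [->|_] /=; last by [].
by rewrite (negPf ZP).
Qed.

Lemma packing_disjoint P X Y : packing P -> X \in P -> Y \in P -> X != Y ->
  [disjoint X & Y].
Proof. by move=> [/trivIsetP tP _ _]; exact: tP. Qed.

Lemma packing_neq0 P X : packing P -> X \in P -> X != set0.
Proof. by move=> [_ P0 _] XP; apply: contraNneq P0 => <-. Qed.

Lemma packingS P Q : Q \subset P -> packing P -> packing Q.
Proof.
move=> sQ pP; have [_ P0 cP] := pP; split.
- apply/trivIsetP => X Y XQ YQ; apply: (packing_disjoint pP); exact: (subsetP sQ).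
- by apply: contraNN P0; apply: (subsetP sQ).
- by move=> B BQ; apply: cP; exact: (subsetP sQ).
Qed.

Lemma packing_add P Z : packing P -> Z != set0 -> connected_in e Z ->
  (forall Y, Y \in P -> [disjoint Z & Y]) -> packing (Z |: P).
Proof.
move=> pP Z0 cZ dZ; have [_ P0 cP] := pP; split.
- apply/trivIsetP => X Y /setU1P[->|XP] /setU1P[->|YP] XY.
  + by rewrite eqxx in XY.
  + exact: dZ.
  + by rewrite disjoint_sym dZ.
  + exact: (packing_disjoint pP).
- by rewrite inE negb_or P0 andbT inE eq_sym.
- by move=> B /setU1P[->//|]; exact: cP.
Qed.

Definition merge P X Y := (X :|: Y) |: (P :\ X :\ Y).

Section Merge.
Variables (P : {set {set T}}) (X Y : {set T}).
Hypotheses (pP : packing P) (XP : X \in P) (YP : Y \in P) (YX : Y != X)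
  (tXY : touch X Y).

Lemma merge_notin : X :|: Y \notin P :\ X :\ Y.
Proof.
apply/negP; rewrite !inE => /and3P[_ ZX ZP].
have /pred0P d := packing_disjoint pP ZP XP ZX.
have /set0Pn[x xX] := packing_neq0 pP XP.
by have := d x; rewrite /= inE xX.
Qed.

Lemma card_merge : #|P| = #|merge P X Y|.+1.
Proof.
rewrite cardsU1 merge_notin (cardsD1 X P) XP (cardsD1 Y (P :\ X)).
by rewrite !inE YX YP.
Qed.

Lemma packing_merge : packing (merge P X Y).
Proof.
have [_ _ cP] := pP.
have sP : P :\ X :\ Y \subset P by apply/subsetP => B; rewrite !inE => /and3P[].
apply: packing_add.
- exact: packingS sP pP.
- have /set0Pn[x xX] := packing_neq0 pP XP.
  by apply/set0Pn; exists x; rewrite inE xX.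
- by apply: connectedU => //; apply: cP.
- move=> B; rewrite !inE => /and3P[BY BX BP].
  by rewrite -setI_eq0 setIUl setU_eq0 !setI_eq0 !(packing_disjoint pP) // eq_sym.
Qed.

(** Contracting an edge destroys that edge and identifies two edges at each common neighbour; each
    lost edge counts twice in [arcs]. *)
Lemma arcs_merge :
  arcs P <= arcs (merge P X Y) + (#|nbhd P X :&: nbhd P Y|).*2 + 2.
Proof.
set P0 := P :\ X :\ Y.
have YP0 : Y \notin P0 by rewrite !inE eqxx.
have XP0 : X \notin Y |: P0 by rewrite !inE eqxx andbF orbF eq_sym.
have eP : P = X |: (Y |: P0).
  by rewrite /P0 !setD1K // !inE YX.
rewrite [X in X <= _](_ : _ = arcs (X |: (Y |: P0))); last by rewrite -eP.
rewrite (arcs_add XP0) (arcs_add YP0) (arcs_add merge_notin) -/P0.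
have -> : nbhd (Y |: P0) X = Y |: nbhd P0 X.
  by apply/setP => Z; rewrite !inE; case: eqP => //= ->; rewrite YX tXY.
rewrite cardsU1 !inE eqxx /=.
have -> : nbhd P0 (X :|: Y) = nbhd P0 X :|: nbhd P0 Y.
  apply/setP => Z; rewrite [in LHS]inE touchUl !inE.
  case: (Z =P Y) => //= ZY; case: (Z =P X) => //= ZX.
  case: (boolP (Z \in P)) => //= ZP.
  suff -> : Z != X :|: Y by [].
  by apply: contraNneq merge_notin => <-; rewrite !inE ZP; apply/and3P; split => //; apply/eqP.
have := cardsUI (nbhd P0 X) (nbhd P0 Y).
have : #|nbhd P0 X :&: nbhd P0 Y| <= #|nbhd P X :&: nbhd P Y|.
  apply: subset_leq_card; apply/subsetP => Z; rewrite !inE.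
  by move=> /andP[/andP[/and3P[-> -> ->] /andP[_ ->]] /andP[_ /andP[_ ->]]].
move: #|nbhd P0 X :&: nbhd P0 Y| #|nbhd P X :&: nbhd P Y| #|nbhd P0 X :|: nbhd P0 Y| (arcs P0) #|nbhd P0 X| #|nbhd P0 Y|. lia.
Qed.

Lemma merge_coarsens P0 : coarsens P P0 -> coarsens (merge P X Y) P0.
Proof.
move=> cP Z /setU1P[->|]; last by rewrite !inE => /and3P[_ _ ZP]; exact: cP.
have [[X' X'P sX] sXP] := cP _ XP; have [_ sYP] := cP _ YP; split.
  by exists X' => //; apply: subset_trans sX (subsetUl _ _).
by rewrite subUset sXP.
Qed.

End Merge.

(* Among the coarsenings with at least [2 ^ r] edges per part, one with fewest
   parts has every touching pair of parts in at least [2 ^ r] triangles: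
   otherwise merging the pair gives a smaller one. *)
Lemma dense_packing_clique r P : packing P -> P != set0 ->
  (forall X, X \in P -> 2 ^ r <= #|nbhd P X|) ->
  exists Q, [/\ packing Q, #|Q| = r,
    forall X Y, X \in Q -> Y \in Q -> X != Y -> touch X Y & coarsens Q P].
Proof.
elim: r P => [|r IH] P pP P0 degP.
  exists set0; split; rewrite ?cards0 //.
  - by apply: packingS pP; exact: sub0set.
  - by move=> X Y; rewrite inE.
  - by move=> Y; rewrite inE.
pose ok m := exists Q, [/\ packing Q, Q != set0, coarsens Q P,
   2 ^ r.+1 * #|Q| <= arcs Q & #|Q| = m].
have ex_ok : exists m, ok m.
  exists #|P|, P; split=> //.
    move=> Y YP; split; last exact: bigcup_sup.
    by exists Y.
  rewrite /arcs mulnC -sum_nat_const; apply: leq_sum => X; exact: degP.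
(* [ok] is a bare proposition, so its least value is found by strong induction and excluded
   middle. *)
have [Q [pQ Q0 cQ dQ minQ]] : exists Q, [/\ packing Q, Q != set0, coarsens Q P,
    2 ^ r.+1 * #|Q| <= arcs Q & forall m, ok m -> #|Q| <= m].
  have [m] := ex_ok; elim/ltn_ind: m => m IHm okm.
  have [[m' [lt_m' okm']]|no] := pselect (exists m', m' < m /\ ok m').
    exact: (IHm m').
  have [Q [pQ Q0 cQ dQ cardQ]] := okm; exists Q; split=> // m' okm'.
  by rewrite cardQ leqNgt; apply/negP => lt_m'; apply: no; exists m'.
have common X Y : X \in Q -> Y \in Q -> Y != X -> touch X Y ->
    2 ^ r <= #|nbhd Q X :&: nbhd Q Y|.
  move=> XQ YQ YX tXY; rewrite leqNgt; apply/negP => lt_c.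
  have := card_merge pQ XQ YQ YX; have := arcs_merge pQ XQ YQ YX tXY.
  set Q' := merge Q X Y => leQ' cardQ'.
  suff : #|Q| <= #|Q'| by rewrite cardQ' ltnn.
  apply: minQ; exists Q'; split=> //.
  - exact: packing_merge.
  - by apply/set0Pn; exists (X :|: Y); rewrite setU11.
  - exact: merge_coarsens.
  (* With at most [2 ^ r - 1] common neighbours the merge loses at most [2 ^ r.+1] arcs, exactly the
     allowance of the part that disappears. *)
  - move: dQ leQ' lt_c; rewrite cardQ' mulnS expnS.
    move: #|_ :&: _| (arcs Q) (arcs Q') (2 ^ r) (2 * 2 ^ r * _) => a b c d f; lia.
have [X XQ /set0Pn[Y0 Y0N]] : exists2 X, X \in Q & nbhd Q X != set0.
  have [X /andP[XQ XN]|no] := pickP [pred X in Q | nbhd Q X != set0].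
    by exists X.
  move: dQ; rewrite /arcs big1 ?leqn0 ?muln_eq0 ?expn_eq0 ?cards_eq0 ?(negPf Q0) //.
  move=> X XQ; have := no X; rewrite /= XQ /= => /negbFE/eqP->.
  by rewrite cards0.
have sN : nbhd Q X \subset Q by apply/subsetP => Z; rewrite inE => /andP[].
(* Inside [nbhd Q X] every part has [2 ^ r] neighbours, by [common]; the [r] parts found there all
   touch [X], which completes the clique. *)
have [||| C [pC cardC tC cC]] := IH (nbhd Q X).
- exact: packingS pQ.
- by apply/set0Pn; exists Y0.
- move=> Y YN; have := YN; rewrite inE => /and3P[YQ YX tXY].
  apply: leq_trans (common X Y XQ YQ YX tXY) _.
  apply: subset_leq_card; apply/subsetP => Z; rewrite in_setI => /andP[ZX].
  by rewrite [Z \in nbhd Q Y]inE => /and3P[_ ZY tYZ]; rewrite inE ZX ZY.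
have dX Y : Y \in C -> [disjoint X & Y].
  move=> YC; have [_ sY] := cC _ YC.
  rewrite disjoint_sym; apply: (disjointWl sY).
  apply/pred0P => z /=; apply/negP => /andP[/bigcupP[B]].
  rewrite inE => /and3P[BQ BX _] zB zX.
  by have /pred0P/(_ z) := packing_disjoint pQ BQ XQ BX; rewrite /= zB zX.
have X0 := packing_neq0 pQ XQ.
have XC : X \notin C.
  by apply/negP => /dX; rewrite -setI_eq0 setIid (negPf X0).
have tXC Y : Y \in C -> touch X Y.
  move=> YC; have [[Z ZN sZ] _] := cC _ YC.
  by move: ZN; rewrite inE => /and3P[_ _]; apply: touchS.
exists (X |: C); split.
- by apply: packing_add => //; have [_ _] := pQ; apply.
- by rewrite cardsU1 XC cardC.
- move=> Y Z /setU1P[->|YC] /setU1P[->|ZC] YZ.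
  + by rewrite eqxx in YZ.
  + exact: tXC.
  + by rewrite touchC tXC.
  + exact: tC.
- move=> Y /setU1P[->|YC]; first exact: cQ.
  have [[Z ZN sZ] sY] := cC _ YC; split.
    have [[W WP sW] _] := cQ _ (subsetP sN _ ZN).
    by exists W => //; apply: subset_trans sZ.
  apply: subset_trans sY _; apply/bigcupsP => Z' /(subsetP sN) Z'Q.
  by have [] := cQ _ Z'Q.
Qed.

Lemma clique_packing_minor Q : packing Q ->
  (forall X Y, X \in Q -> Y \in Q -> X != Y -> touch X Y) -> has_K_minor #|Q| e.
Proof.
move=> pQ tQ; have [_ _ cQ] := pQ; exists (@enum_val _ (mem Q)); split.
- by move=> i; apply: (packing_neq0 pQ); exact: enum_valP.
- by move=> i; apply: cQ; exact: enum_valP.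
- move=> i j ij; apply: (packing_disjoint pQ); rewrite ?enum_valP //.
  by apply: contraNneq ij => /enum_val_inj->.
- move=> i j ij; apply/touchP; apply: tQ; rewrite ?enum_valP //.
  by apply: contraNneq ij => /enum_val_inj->.
Qed.

Hypothesis e_irr : irreflexive e.

(** Otherwise the singletons of [S] form a packing to which [dense_packing_clique] applies, and its
    [r] mutually touching parts are a minor. *)
Lemma minor_free_low_degree r (S : {set T}) : ~ has_K_minor r e -> S != set0 ->
  exists2 v, v \in S & #|[set w in S | e v w]| < 2 ^ r.
Proof.
move=> noK S0.
have [v /andP[vS dv]|no] := pickP [pred v in S | #|[set w in S | e v w]| < 2 ^ r].
  by exists v.
case: noK; pose P := [set [set v] | v in S].
have tP v w : touch [set v] [set w] = e v w.
  apply/touchP/idP => [[x [y [/set1P-> /set1P->]]]//|evw].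
  by exists v, w; rewrite !set11.
have [||| Q [pQ <- tQ _]] := @dense_packing_clique r P; last exact: clique_packing_minor.
- split.
  + apply/trivIsetP => X Y /imsetP[x _ ->] /imsetP[y _ ->] xy.
    by rewrite disjoints1 inE; apply: contraNneq xy => ->.
  + by apply/imsetP => -[x _ /setP/(_ x)]; rewrite !inE eqxx.
  + by move=> B /imsetP[x _ ->]; exact: connected1.
- have /set0Pn[v vS] := S0; apply/set0Pn; exists [set v]; exact: imset_f.
- move=> X /imsetP[v vS ->]; have := no v; rewrite /= vS /= => /negbT.
  rewrite -leqNgt => le_d; apply: leq_trans le_d _.
  rewrite -(card_imset _ (@set1_inj _)); apply: subset_leq_card.
  apply/subsetP => X' /imsetP[w]; rewrite inE => /andP[wS evw] ->.
  rewrite inE imset_f // tP evw andbT; apply: contraTneq evw => /set1_inj->.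
  by rewrite e_irr.
Qed.

(* [o] orients each edge towards the endpoint removed later in a degeneracy order. *)
Lemma minor_free_orientation r : ~ has_K_minor r e ->
  exists o : rel T, [/\ forall u v, e u v = o u v || o v u,
    forall u v, ~~ (o u v && o v u) & forall u, #|[set v | o u v]| <= 2 ^ r].
Proof.
move=> noK.
suff oS (S : {set T}) : exists o : rel T,
   [/\ forall u v, [&& e u v, u \in S & v \in S] = o u v || o v u,
    forall u v, ~~ (o u v && o v u) & forall u, #|[set v | o u v]| <= 2 ^ r].
  by have [o [oe oN od]] := oS setT; exists o; split=> // u v; rewrite -oe !inE !andbT.
elim/ltn_ind: {S}#|S| {-2}S (erefl #|S|) => m IH S cardS.
have [->|S0] := eqVneq S set0.
  exists (fun _ _ => false); split=> //= u; first by move=> v; rewrite !inE /= andbF.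
  by rewrite (_ : [set v | false] = set0) ?cards0 //; apply/setP => v; rewrite !inE.
have [v vS dv] := minor_free_low_degree noK S0.
have [|o [oe oN od]] := IH #|S :\ v| _ (S :\ v) (erefl _).
  by rewrite -cardS [X in _ < X](cardsD1 v) vS.
(* All edges from the low-degree vertex [v] into [S] leave [v]; the test [w != v] keeps arcs from
   entering it. *)
exists (fun u w => if u == v then (w \in S) && e v w else (w != v) && o u w); split.
- move=> u w; have := oe u w; rewrite !inE.
  have [->|uv] := eqVneq u v; have [->|wv] := eqVneq w v; rewrite /= ?e_irr ?andbF ?orbF //.
    by rewrite vS /= andbC.
  by rewrite e_sym vS andbT andbC.
- move=> u w; have [->|uv] := eqVneq u v; have [->|wv] := eqVneq w v;
    rewrite /= ?e_irr ?andbF //; exact: oN.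
- move=> u; have [_|uv] := eqVneq u v.
    exact: (leq_trans _ (ltnW dv)).
  apply: leq_trans _ (od u); apply: subset_leq_card; apply/subsetP => w.
  by rewrite !inE => /andP[].
Qed.


(** * Vertices joined to a whole set *)

Lemma exists_injection (L C : {set T}) : #|L| <= #|C| ->
  (* Elements are matched by rank in the two enumerations; on [L] the index is in range, so the
     default of [nth] is never returned. *)
  exists f : T -> T, {in L, forall u, f u \in C} /\ {in L &, injective f}.
Proof.
move=> leLC; exists (fun u => nth u (enum C) (index u (enum L))).
have lt_i u : u \in L -> index u (enum L) < size (enum C).
  by move=> uL; rewrite -cardE (leq_trans _ leLC) // cardE index_mem mem_enum.
split=> [u uL|u v uL vL]; first by rewrite -mem_enum mem_nth ?lt_i.
rewrite (set_nth_default u) ?lt_i // => /eqP.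
rewrite nth_uniq ?lt_i ?enum_uniq // => /eqP eq_i.
by rewrite -(nth_index u (_ : u \in enum L)) ?mem_enum // eq_i nth_index ?mem_enum.
Qed.

Definition joined (L : {set T}) := [set v | (v \notin L) && [forall u in L, e u v]].

Lemma joinedP L u v : v \in joined L -> u \in L -> e u v.
Proof. by rewrite inE => /andP[_ /forall_inP]; apply. Qed.

Lemma joined_notin L v : v \in joined L -> v \notin L.
Proof. by rewrite inE => /andP[]. Qed.

(* Matching [L] into its common neighbourhood turns [L] into a clique of pairs. *)
Lemma joined_minor (L X Y : {set T}) :
  X != set0 -> Y != set0 -> connected_in e X -> connected_in e Y ->
  [disjoint X & L] -> [disjoint Y & L] -> [disjoint X & Y] -> touch X Y ->
  (forall u, u \in L -> touch [set u] X) -> (forall u, u \in L -> touch [set u] Y) ->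
  #|L| <= #|joined L :\: (X :|: Y)| -> has_K_minor #|L|.+2 e.
Proof.
move=> X0 Y0 cX cY dXL dYL dXY tXY tX tY /exists_injection[c [cC c_inj]].
have cF u : u \in L -> c u \in joined L by move=> /cC /setDP[].
have cL u : u \in L -> c u \notin L by move=> /cF /joined_notin.
pose B u := [set u; c u].
have BI u v x : u \in L -> v \in L -> x \in B u -> x \in B v -> u = v.
  move=> uL vL /set2P[->|->] /set2P[//|].
  - by move=> uc; move: (cL v vL); rewrite -uc uL.
  - by move=> cv; move: (cL u uL); rewrite cv vL.
  - exact: c_inj.
have Bdisj Z u : u \in L -> [disjoint Z & L] -> Z \subset X :|: Y -> [disjoint Z & B u].
  move=> uL /pred0P dZ sZ; apply/pred0P => x /=; apply/negP => /andP[xZ /set2P[xu|xu]].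
    by have := dZ x; rewrite /= xZ xu uL.
  by have := cC u uL; rewrite inE -xu (subsetP sZ).
have tB u Z : u \in L -> touch [set u] Z -> touch (B u) Z.
  by move=> _; apply: touchS => //; rewrite sub1set set21.
pose P1 := [set B u | u in L].
have pP1 : packing P1.
  split.
  - apply/trivIsetP => _ _ /imsetP[u uL ->] /imsetP[v vL ->] uv.
    apply/pred0P => x /=; apply/negP => /andP[xu xv].
    by move: uv; rewrite (BI _ _ _ uL vL xu xv) eqxx.
  - by apply/imsetP => -[u _ /setP/(_ u)]; rewrite !inE eqxx.
  - move=> _ /imsetP[u uL ->]; apply: connectedU; try exact: connected1.
    by apply/touchP; exists u, (c u); rewrite !set11 (joinedP (cF u uL)).
have cardP1 : #|P1| = #|L|.
  apply: card_in_imset => u v uL vL /setP/(_ u); rewrite [in LHS]inE set11 /= => /esym uB.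
  by apply: (BI u v u) => //; rewrite set21.
have pP2 : packing (Y |: P1).
  apply: packing_add => // _ /imsetP[u uL ->].
  by apply: Bdisj => //; exact: subsetUr.
have YP1 : Y \notin P1.
  apply/imsetP => -[u uL YB]; have := Bdisj Y u uL dYL (subsetUr _ _).
  by rewrite -YB -setI_eq0 setIid (negPf Y0).
have dX Z : Z \in Y |: P1 -> [disjoint X & Z].
  case/setU1P=> [->//|/imsetP[u uL ->]].
  by apply: Bdisj => //; exact: subsetUl.
have XP2 : X \notin Y |: P1.
  by apply/negP => /dX; rewrite -setI_eq0 setIid (negPf X0).
have -> : #|L|.+2 = #|X |: (Y |: P1)| by rewrite cardsU1 XP2 cardsU1 YP1 cardP1.
apply: clique_packing_minor; first exact: packing_add.
have tXB Z : Z \in Y |: P1 -> touch X Z.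
  case/setU1P=> [->//|/imsetP[u uL ->]].
  by rewrite touchC; apply: tB => //; exact: tX.
have tYB Z : Z \in P1 -> touch Y Z.
  case/imsetP=> u uL ->.
  by rewrite touchC; apply: tB => //; exact: tY.
move=> Z W /setU1P[->|Z2] /setU1P[->|W2] ZW.
- by rewrite eqxx in ZW.
- exact: tXB.
- by rewrite touchC tXB.
move: Z2 W2 ZW => /setU1P[->|Z1] /setU1P[->|W1] ZW.
- by rewrite eqxx in ZW.
- exact: tYB.
- by rewrite touchC tYB.
move: Z1 W1 ZW => /imsetP[u uL ->] /imsetP[v vL ->] ZW.
apply/touchP; exists u, (c v); rewrite set21 set22; split=> //.
exact: joinedP (cF v vL) uL.
Qed.

Section Free.
Variable L : {set T}.
Hypothesis noK : ~ has_K_minor #|L|.+2 e.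

Lemma touch1 u X v : v \in X -> e u v -> touch [set u] X.
Proof. by move=> vX euv; apply/touchP; exists u, v; rewrite set11. Qed.

Lemma joined_room (X : {set T}) m : #|X| <= m -> #|L| + m <= #|joined L| ->
  #|L| <= #|joined L :\: X|.
Proof.
move=> cX cJ; rewrite cardsD; have := subset_leq_card (subsetIr (joined L) X); lia.
Qed.

(** With two such neighbours [a] and [b], the branch sets [{u, a}] and [{b}] touch through the edge
    [u b] and both see all of [L]. The slack 3 leaves [#|L|] joined vertices after [u], [a], [b] are
    removed. *)
Lemma few_common_nbrs u : u \notin L ->
  #|[set v in joined L | e u v]| < #|L| + 3.
Proof.
move=> uL; rewrite ltnNge; apply/negP => leC.
have sJ : [set v in joined L | e u v] \subset joined L.
  by apply/subsetP => v; rewrite inE => /andP[].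
have /card_gt1P[a [b [aC bC ab]]] : 1 < #|[set v in joined L | e u v]| by lia.
move: aC bC; rewrite !in_set => /andP[aJ ua] /andP[bJ ub].
have [aJ' bJ'] : a \in joined L /\ b \in joined L by rewrite !in_set.
have [aL bL] := (joined_notin aJ', joined_notin bJ').
have nu v : e u v -> v != u by apply: contraTneq => ->; rewrite e_irr.
apply: noK; apply: (@joined_minor L [set u; a] [set b]).
- by apply/set0Pn; exists u; rewrite set21.
- by apply/set0Pn; exists b; rewrite set11.
- by apply: connectedU; rewrite ?(touch1 (set11 _)) //; exact: connected1.
- exact: connected1.
- by rewrite -setI_eq0 setIUl setU_eq0 !setI_eq0 !disjoints1 uL.
- by rewrite disjoints1.
- by rewrite disjoint_sym disjoints1 !inE negb_or nu // eq_sym.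
- by apply/touchP; exists u, b; rewrite set21 set11.
- by move=> w wL; apply: (touch1 (set22 _ _)); exact: (joinedP aJ').
- by move=> w wL; apply: (touch1 (set11 _)); exact: (joinedP bJ').
- apply: (@joined_room _ 3); last exact: leq_trans leC (subset_leq_card sJ).
  by rewrite (leq_trans (leq_card_setU _ _)) // cards2 cards1; case: (u != a).
Qed.

Hypothesis room : #|L| + 3 <= #|joined L|.

(** The two ends of an edge between joined vertices would serve as branch sets [X] and [Y] in
    [joined_minor]. *)
Lemma joined_independent v w : v \in joined L -> w \in joined L -> ~~ e v w.
Proof.
move=> vJ wJ; apply/negP => evw.
have [vL wL] := (joined_notin vJ, joined_notin wJ).
apply: noK; apply: (@joined_minor L [set v] [set w]).
- by apply/set0Pn; exists v; rewrite set11.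
- by apply/set0Pn; exists w; rewrite set11.
- exact: connected1.
- exact: connected1.
- by rewrite disjoints1.
- by rewrite disjoints1.
- by rewrite disjoints1 inE; apply: contraTneq evw => ->; rewrite e_irr.
- by apply/touchP; exists v, w; rewrite !set11.
- by move=> u uL; apply: (touch1 (set11 _)); exact: (joinedP vJ).
- by move=> u uL; apply: (touch1 (set11 _)); exact: (joinedP wJ).
- apply: (joined_room _ room).
  by rewrite (leq_trans (leq_card_setU _ _)) // !cards1.
Qed.

(** The branch sets are those of [few_common_nbrs], but [room] now supplies the vertices matched to
    [L], so already two neighbours of [u] are too many. *)
Lemma joined_nbr_unique u v w : u \notin L -> v \in joined L -> w \in joined L ->
  e u v -> e u w -> v = w.
Proof.
move=> uL vJ wJ uv uw; apply/eqP; apply/negPn/negP => vw.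
have [vL wL] := (joined_notin vJ, joined_notin wJ).
have nu x : e u x -> x != u by apply: contraTneq => ->; rewrite e_irr.
apply: noK; apply: (@joined_minor L [set u; v] [set w]).
- by apply/set0Pn; exists u; rewrite set21.
- by apply/set0Pn; exists w; rewrite set11.
- by apply: connectedU; rewrite ?(touch1 (set11 _)) //; exact: connected1.
- exact: connected1.
- by rewrite -setI_eq0 setIUl setU_eq0 !setI_eq0 !disjoints1 uL.
- by rewrite disjoints1.
- by rewrite disjoint_sym disjoints1 !inE negb_or nu // eq_sym.
- by apply/touchP; exists u, w; rewrite set21 set11.
- by move=> x xL; apply: (touch1 (set22 _ _)); exact: (joinedP vJ).
- by move=> x xL; apply: (touch1 (set11 _)); exact: (joinedP wJ).
- apply: (joined_room _ room).
  by rewrite (leq_trans (leq_card_setU _ _)) // cards2 cards1; case: (u != v).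
Qed.

End Free.
End Packings.

(** * The competitor: a graph on the hubs joined to an independent set *)

Section JoinIndep.
Local Open Scope nat_scope.

(** An empty [e] gives a complete bipartite graph; the extremal [e] gives the graph it is compared
    with. *)
Definition join_indep n (L : {set 'I_n}) (e : rel 'I_n) : rel 'I_n :=
  fun u v => if u \in L then (v \notin L) || e u v else v \in L.

Lemma join_indep_simple n (L : {set 'I_n}) (e : rel 'I_n) :
  simple_graph e -> simple_graph (join_indep L e).
Proof.
move=> [es ei]; split=> [u v|u]; rewrite /join_indep; last first.
  by case: ifP => [->|->]; rewrite ?ei.
by case: (u \in L); case: (v \in L) => //=; rewrite es.
Qed.

(** Disjoint branch sets meeting [L] number at most [#|L|], so two of the [#|L| + 2] avoid [L]; no
    edge joins those two. *)
Lemma join_indep_minor_free n (L : {set 'I_n}) (e : rel 'I_n) :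
  ~ has_K_minor #|L|.+2 (join_indep L e).
Proof.
move=> [B [B0 _ dB tB]].
pose I := [set i | B i :&: L != set0].
pose f i := [pick x in B i :&: L].
have fP i : i \in I -> exists2 x, f i = Some x & x \in B i :&: L.
  rewrite inE /f => /set0Pn[x xBL]; case: pickP => [y yBL|/(_ x)]; last by rewrite xBL.
  by exists y.
have leI : #|I| <= #|L|.
  rewrite -(card_in_imset (f := f) (D := I)).
    apply: leq_trans (eq_leq (card_imset L (@Some_inj _))); apply: subset_leq_card.
    apply/subsetP => _ /imsetP[i /fP[x -> /setIP[_ xL]] ->].
    exact: imset_f.
  move=> i j /fP[x -> /setIP[xi _]] /fP[y -> /setIP[yj _]] [xy].
  apply/eqP/negPn/negP => /dB/pred0P/(_ x) /=.
  by rewrite xi xy yj.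
have /card_gt1P[i [j [iI jI ij]]] : 1 < #|~: I|.
  by have := cardsC I; rewrite card_ord; lia.
have [x [y [xi yj]]] := tB i j ij.
have notL k z : k \in ~: I -> z \in B k -> z \notin L.
  rewrite !inE negbK => /eqP/setP/(_ z); rewrite !inE => BL zB.
  by move: BL; rewrite zB /= => ->.
by rewrite /join_indep (negPf (notL i x iI xi)) (negPf (notL j y jI yj)).
Qed.

End JoinIndep.

(** * Extreme eigenvalues *)

Definition quad (R : realType) n (M : 'I_n -> 'I_n -> R) (x : 'I_n -> R) : R :=
  \sum_i \sum_j M i j * x i * x j.

Definition sqn (R : realType) n (x : 'I_n -> R) : R := \sum_i x i ^+ 2.

Lemma continuous_sum (R : realType) (T : topologicalType) (I : Type) (r : seq I)
    (F : I -> T -> R) :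
  (forall i, continuous (F i)) -> continuous (fun x => \sum_(i <- r) F i x).
Proof.
move=> cF x; elim: r => [|i r IH].
  by under eq_fun do rewrite big_nil; exact: cvg_cst.
under eq_fun do rewrite big_cons; apply: cvgD => //; exact: cF.
Qed.

Section Spectral.
Variables (R : realType) (n : nat).
Implicit Types (M : 'I_n -> 'I_n -> R) (x y h : 'I_n -> R).

Lemma sqn_ge0 x : 0 <= sqn x.
Proof. by apply: sumr_ge0 => i _; exact: sqr_ge0. Qed.

Lemma sqn_eq0 x : (sqn x == 0) = [forall i, x i == 0].
Proof.
rewrite /sqn psumr_eq0 => [|i _]; last exact: sqr_ge0.
by apply/allP/forallP => x0 i; have := x0 i; rewrite sqrf_eq0 ?mem_index_enum //; apply.
Qed.

Lemma sqnZ c x : sqn (fun i => c * x i) = c ^+ 2 * sqn x.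
Proof. by rewrite /sqn mulr_sumr; apply: eq_bigr => i _; rewrite exprMn. Qed.

Lemma quadZ M c x : quad M (fun i => c * x i) = c ^+ 2 * quad M x.
Proof.
rewrite /quad mulr_sumr; apply: eq_bigr => i _; rewrite mulr_sumr.
by apply: eq_bigr => j _; ring.
Qed.

Lemma quadN M x : quad (fun i j => - M i j) x = - quad M x.
Proof.
rewrite /quad -sumrN; apply: eq_bigr => i _; rewrite -sumrN.
by apply: eq_bigr => j _; rewrite !mulNr.
Qed.

Lemma quad_eigen M a y : (forall i, \sum_j M i j * y j = a * y i) ->
  quad M y = a * sqn y.
Proof.
move=> My; rewrite /quad /sqn mulr_sumr; apply: eq_bigr => i _.
by rewrite expr2 mulrA -My mulr_suml; apply: eq_bigr => j _; ring.
Qed.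

(** The one-coordinate variation from which [max_eigenvector] reads off the eigenvalue equation. *)
Lemma quad_delta M x k t : (forall i j, M i j = M j i) ->
  quad M (fun i => x i + t * (i == k)%:R) =
  quad M x + t *+ 2 * (\sum_j M k j * x j) + t ^+ 2 * M k k.
Proof.
move=> Ms.
have -> : quad M (fun i => x i + t * (i == k)%:R) =
  \sum_i \sum_j (M i j * x i * x j + t * ((i == k)%:R * (M i j * x j)) +
     (t * ((j == k)%:R * (M i j * x i)) + t ^+ 2 * ((j == k)%:R * ((i == k)%:R * M i j)))).
  by apply: eq_bigr => i _; apply: eq_bigr => j _; ring.
have sel (F : 'I_n -> R) : \sum_i (i == k)%:R * F i = F k.
  rewrite (bigD1 k) //= eqxx mul1r big1 ?addr0 // => i /negPf->.
  by rewrite mul0r.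
under eq_bigr do rewrite !big_split /= -!mulr_sumr !sel.
rewrite !big_split /= -!mulr_sumr -/(quad M x) !sel.
have -> : \sum_i M i k * x i = \sum_i M k i * x i by apply: eq_bigr => i _; rewrite Ms.
by ring.
Qed.

(** The unit sphere is closed in the compact box [[-1, 1] ^ n], so the form has a maximum there;
    homogeneity extends the inequality to every [x]. *)
Lemma quad_max_attained M : (0 < n)%N ->
  exists y, sqn y = 1 /\ forall x, quad M x <= quad M y * sqn x.
Proof.
move=> n0.
pose f (v : 'rV[R]_n) := quad M (fun i => v 0 i).
pose g (v : 'rV[R]_n) := sqn (fun i => v 0 i).
have cC i : continuous (fun v : 'rV[R]_n => v 0 i) by exact: coord_continuous.
have cf : continuous f.
  apply: continuous_sum => i; apply: continuous_sum => j v.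
  exact: (continuousM (continuousM (@cst_continuous _ _ (M i j) v) (cC i v)) (cC j v)).
have cg : continuous g.
  apply: continuous_sum => i v.
  exact: (continuousM (cC i v) (cC i v)).
pose A : set 'rV[R]_n := [set v | g v = 1]%classic.
have cA : compact A.
  have box : compact [set v : 'rV[R]_n | forall i, `[(-1 : R), 1]%classic (v ord0 i)]%classic.
    by apply: (@rV_compact R n (fun=> `[(-1 : R), 1]%classic)) => _; exact: segment_compact.
  apply: subclosed_compact _ box _.
    exact: (closed_comp (fun v _ => cg v) (@closed_eq R 1)).
  move=> v /= gv i; rewrite in_itv /= -ler_norml -(@ler_pXn2r _ 2) ?nnegrE //.
  rewrite expr1n real_normK ?num_real // -gv /g /sqn (bigD1 i) //=.
  by rewrite lerDl sumr_ge0 // => j _; exact: sqr_ge0.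
have A0 : (A !=set0)%classic.
  exists (\row_i (i == Ordinal n0)%:R); rewrite /A /= /g /sqn (bigD1 (Ordinal n0)) //=.
  rewrite mxE eqxx expr1n big1 ?addr0 // => i /negPf i0.
  by rewrite mxE i0 expr0n.
have [c cA' maxc] := EVT_max_rV A0 cA (continuous_subspaceT cf).
exists (fun i => c 0 i); split; first by move: cA'; rewrite classical_sets.in_setE.
move=> x; have [x0|x0] := eqVneq (sqn x) 0.
  have {}x0 i : x i = 0 by move/eqP: x0; rewrite sqn_eq0 => /forallP/(_ i)/eqP.
  have -> : quad M x = 0.
    by rewrite /quad big1 // => i _; rewrite big1 // => j _; rewrite x0 mulr0 mul0r.
  by rewrite /sqn big1 ?mulr0 // => i _; rewrite x0 expr0n.
have sx : 0 < sqn x by rewrite lt_neqAle eq_sym x0 sqn_ge0.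
pose s := Num.sqrt (sqn x).
have s2 : s ^+ 2 = sqn x by rewrite sqr_sqrtr // ltW.
have s0 : s != 0 by rewrite sqrtr_eq0 -ltNge.
have /maxc : (\row_i (s^-1 * x i)) \in A.
  rewrite classical_sets.in_setE /A /= /g (_ : (fun _ => _) = (fun i => s^-1 * x i)).
    by rewrite sqnZ exprVn s2 mulVf.
  by apply/funext => i; rewrite mxE.
rewrite {1}/f (_ : (fun _ => _) = (fun i => s^-1 * x i)); last first.
  by apply/funext => i; rewrite mxE.
by rewrite quadZ exprVn s2 mulrC ler_pdivrMr.
Qed.

(* First-order optimality at a maximizer of the Rayleigh quotient is the eigenvalue equation. *)
Lemma max_eigenvector M : (0 < n)%N -> (forall i j, M i j = M j i) ->
  exists a y, [/\ sqn y = 1, forall i, \sum_j M i j * y j = a * y i &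
    forall x, quad M x <= a * sqn x].
Proof.
move=> n0 Ms; have [y [y1 ymax]] := quad_max_attained M n0.
exists (quad M y), y; split=> // k; apply/eqP/negPn/negP => neq.
set a := quad M y in ymax neq *.
set b := \sum_j M k j * y j in neq *.
have ineq t : t *+ 2 * (b - a * y k) + t ^+ 2 * (M k k - a) <= 0.
  have := ymax (fun i => y i + t * (i == k)%:R).
  rewrite quad_delta // -/a -/b.
  suff -> : sqn (fun i => y i + t * (i == k)%:R) = 1 + t *+ 2 * y k + t ^+ 2 by nra.
  rewrite -[in RHS]y1 /sqn (bigD1 k) //= [in RHS](bigD1 k) //= eqxx.
  have -> : \sum_(i | i != k) (y i + t * (i == k)%:R) ^+ 2 = \sum_(i | i != k) y i ^+ 2.
    by apply: eq_bigr => i /negPf ->; rewrite mulr0 addr0.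
  by rewrite mulr1; ring.
have d0 : b - a * y k != 0 by rewrite subr_eq0.
set d := b - a * y k in ineq d0; set c := M k k - a in ineq.
have d2 : 0 < d ^+ 2 by rewrite lt_neqAle eq_sym sqrf_eq0 d0 sqr_ge0.
have C1 : 0 < `|c| + 1 by have := normr_ge0 c; lra.
(* This [t] has the sign of [d] and is small enough for the linear term to dominate: the left side
   becomes a positive multiple of [2 (|c| + 1) + c]. *)
have := ineq (d / (`|c| + 1)).
have -> : d / (`|c| + 1) *+ 2 * d + (d / (`|c| + 1)) ^+ 2 * c =
  d ^+ 2 / (`|c| + 1) ^+ 2 * (2 * (`|c| + 1) + c) by field; lra.
apply/negP; rewrite -ltNge mulr_gt0 //.
  by rewrite divr_gt0 // exprn_gt0.
have := ler_norm (- c); rewrite normrN; lra.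
Qed.

End Spectral.

Section Spread.
Variables (R : realType) (n : nat) (e : rel 'I_n).
Hypotheses (n0 : (0 < n)%N) (e_sym : symmetric e).

Definition adj (i j : 'I_n) : R := (e i j)%:R.

Lemma adjC i j : adj i j = adj j i.
Proof. by rewrite /adj e_sym. Qed.

Lemma adjmx_eigen a (y : 'I_n -> R) : sqn y = 1 ->
  (forall i, \sum_j adj i j * y j = a * y i) -> eigenvalue (adjmx R e) a.
Proof.
move=> y1 ey; apply/eigenvalueP; exists (\row_i y i).
  apply/rowP => i; rewrite !mxE -ey; apply: eq_bigr => j _.
  by rewrite !mxE mulrC -/(adj j i) adjC.
apply/eqP => /rowP y0; move: y1; rewrite /sqn big1 => [/eqP|i _].
  by rewrite eq_sym oner_eq0.
by have := y0 i; rewrite !mxE => ->; rewrite expr0n.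
Qed.

Lemma eigen_adjmx a : eigenvalue (adjmx R e) a ->
  exists2 y : 'I_n -> R, 0 < sqn y & quad adj y = a * sqn y.
Proof.
move=> /eigenvalueP[v ev v0]; exists (fun i => v 0 i).
  rewrite lt_neqAle sqn_ge0 andbT eq_sym sqn_eq0; apply: contraNN v0 => /forallP v0.
  by apply/eqP/rowP => i; rewrite mxE; apply/eqP.
apply: quad_eigen => i; have /rowP/(_ i) := ev; rewrite !mxE => <-.
by apply: eq_bigr => j _; rewrite !mxE mulrC -/(adj j i) adjC.
Qed.

(** The least eigenvalue is written [- b], with [b] the largest eigenvalue of [- adj], so both ends
    of the spectrum are maxima of quadratic forms. *)
Lemma spread_exists : exists a b (y z : 'I_n -> R), [/\
  [/\ sqn y = 1, forall i, \sum_j adj i j * y j = a * y i &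
    forall x, quad adj x <= a * sqn x],
  [/\ sqn z = 1, forall i, \sum_j adj i j * z j = - b * z i &
    forall x, - quad adj x <= b * sqn x] &
  is_spread (adjmx R e) (a + b)].
Proof.
have [a [y [y1 ey maxy]]] := max_eigenvector n0 adjC.
have [|b [z [z1 ez maxz]]] := @max_eigenvector R n (fun i j => - adj i j) n0.
  by move=> i j; rewrite adjC.
have {}ez i : \sum_j adj i j * z j = - b * z i.
  rewrite mulNr -ez -sumrN; apply: eq_bigr => j _; ring.
have {}maxz x : - quad adj x <= b * sqn x by rewrite -quadN.
exists a, b, y, z; split=> //; split.
  exists a, (- b); split; last by rewrite opprK.
    exact: adjmx_eigen y1 ey.
  exact: adjmx_eigen z1 ez.
move=> a' b' /eigen_adjmx[v v0 ev] /eigen_adjmx[w w0 ew].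
apply: lerD.
  by rewrite -(ler_pM2r v0) -ev.
by rewrite -(ler_pM2r w0) mulNr -ew.
Qed.

End Spread.

(** * Weighted bounds on adjacency forms *)

Section WeightedBounds.
Variables (R : realType) (n : nat).
Implicit Types (p : rel 'I_n) (x : 'I_n -> R) (w : 'I_n -> 'I_n -> R).

(** On each arc [2 |x u x v| <= w x u ^ 2 + x v ^ 2 / w]. Collecting the terms at each vertex leaves
    the assumed weight sums. *)
Lemma quad_weighted_bound p w x c :
  (forall u v, p u v -> 0 < w u v) ->
  (forall u, \sum_v adj R p u v * w u v + \sum_v adj R p v u / w v u <= c) ->
  `|quad (adj R p) x| *+ 2 <= c * sqn x.
Proof.
move=> w0 wc.
have step : `|quad (adj R p) x| *+ 2 <=
    \sum_u \sum_v adj R p u v * (w u v * x u ^+ 2 + x v ^+ 2 / w u v).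
  apply: le_trans (ler_wMn2r 2 (ler_norm_sum _ _ _)) _.
  rewrite -sumrMnl; apply: ler_sum => u _.
  apply: le_trans (ler_wMn2r 2 (ler_norm_sum _ _ _)) _.
  rewrite -sumrMnl; apply: ler_sum => v _; rewrite /adj.
  have [puv|_] := boolP (p u v); last by rewrite !mul0r normr0 mul0rn.
  rewrite !mul1r normrM; have w1 := w0 u v puv.
  have := sqr_ge0 (w u v * `|x u| - `|x v|).
  rewrite -[x u ^+ 2](real_normK (num_real _)) -[x v ^+ 2](real_normK (num_real _)).
  set a := `|x u|; set b := `|x v|; move: w1; set z := w u v => z0 sq.
  rewrite -(ler_pM2r z0).
  have -> : (z * a ^+ 2 + b ^+ 2 / z) * z = (z * a) ^+ 2 + b ^+ 2 by field; lra.
  by rewrite mulr2n; nra.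
apply: le_trans step _.
under eq_bigr => u _ do under eq_bigr => v _ do rewrite mulrDr.
under eq_bigr => u _ do rewrite big_split.
rewrite big_split /= [X in _ + X]exchange_big /= -big_split /= /sqn mulr_sumr.
apply: ler_sum => u _.
apply: le_trans (ler_wpM2r (sqr_ge0 (x u)) (wc u)).
rewrite mulrDl !mulr_suml lerD //; apply: ler_sum => v _.
  by rewrite mulrA.
by rewrite mulrCA [X in X <= _]mulrC mulrAC.
Qed.

Lemma quadD (M1 M2 : 'I_n -> 'I_n -> R) x :
  quad (fun i j => M1 i j + M2 i j) x = quad M1 x + quad M2 x.
Proof.
rewrite /quad -big_split; apply: eq_bigr => i _; rewrite -big_split.
by apply: eq_bigr => j _; rewrite !mulrDl.
Qed.

Lemma quad_flip (M : 'I_n -> 'I_n -> R) x : quad (fun i j => M j i) x = quad M x.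
Proof.
rewrite /quad exchange_big; apply: eq_bigr => i _; apply: eq_bigr => j _.
by rewrite mulrAC.
Qed.

Lemma eq_quad (M1 M2 : 'I_n -> 'I_n -> R) x : (forall i j, M1 i j = M2 i j) ->
  quad M1 x = quad M2 x.
Proof. by move=> eM; apply: eq_bigr => i _; apply: eq_bigr => j _; rewrite eM. Qed.

Lemma sum_adj p u (c : R) : \sum_v adj R p u v * c = #|[set v | p u v]|%:R * c.
Proof.
rewrite -mulr_suml /adj -sum1_card natr_sum [X in _ = X * _]big_mkcond /=; congr (_ * _).
by apply: eq_bigr => v _; rewrite inE; case: (p u v).
Qed.

Lemma sum_adj_flip p u (c : R) : \sum_v adj R p v u * c = #|[set v | p v u]|%:R * c.
Proof.
rewrite -mulr_suml /adj -sum1_card natr_sum [X in _ = X * _]big_mkcond /=; congr (_ * _).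
by apply: eq_bigr => v _; rewrite inE; case: (p v u).
Qed.

(** A constant weight [t] charges out-degrees at rate [t] and in-degrees at rate [1 / t]; balancing
    them gives order [sqrt (d D)], small when only [d] is bounded but [D = o(n)]. *)
Lemma oriented_bound p (S : {set 'I_n}) (d : nat) (D t : R) x :
  0 < t ->
  (forall u, (#|[set v | p u v]| <= d)%N) ->
  (forall u, u \in S -> #|[set v in S | p v u]|%:R <= D) -> 0 <= D ->
  `|quad (adj R (fun u v => [&& p u v, u \in S & v \in S])) x| *+ 2
    <= (t * d%:R + D / t) * sqn x.
Proof.
move=> t0 pd pD D0; apply: (@quad_weighted_bound _ (fun _ _ => t)) => // u.
rewrite sum_adj sum_adj_flip [X in X <= _]addrC [X in _ <= X]addrC; apply: lerD.
  rewrite ler_wpM2r ?invr_ge0 ?(ltW t0) //.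
  have [uS|uS] := boolP (u \in S); last first.
    by rewrite eq_card0 // => v; rewrite !inE !andbF.
  apply: le_trans _ (pD u uS); rewrite ler_nat; apply: subset_leq_card.
  by apply/subsetP => v; rewrite !inE /= andbT => /andP[-> ->].
rewrite mulrC ler_wpM2l ?(ltW t0) // ler_nat; apply: leq_trans _ (pd u).
by apply: subset_leq_card; apply/subsetP => v; rewrite !inE => /andP[].
Qed.

End WeightedBounds.

(** * Existence of hubs *)

Section Degrees.
Local Open Scope nat_scope.
Variables (n : nat) (e : rel 'I_n).
Hypotheses (e_sym : symmetric e) (e_irr : irreflexive e).
Local Notation T := 'I_n.

Definition deg u := #|[set v | e u v]|.

Lemma deg_le u : deg u <= n.
Proof. by rewrite -[X in _ <= X](card_ord n) max_card. Qed.

Lemma degree_sum r : ~ has_K_minor r e -> \sum_u deg u <= 2 ^ r.+1 * n.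
Proof.
move=> noK; have [o [eo _ od]] := minor_free_orientation e_sym e_irr noK.
have flip : \sum_u #|[set v | o v u]| = \sum_u #|[set v | o u v]|.
  have cnt (p : rel T) u : #|[set v | p u v]| = \sum_v p u v.
    by rewrite -sum1_card big_mkcond; apply: eq_bigr => v _; rewrite inE; case: (p u v).
  under eq_bigr do rewrite (cnt (fun u v => o v u)).
  by rewrite exchange_big; apply: eq_bigr => u _; rewrite cnt.
apply: (@leq_trans (\sum_u (#|[set v | o u v]| + #|[set v | o v u]|))).
  apply: leq_sum => u _; apply: leq_trans _ (leq_card_setU _ _).
  by apply: subset_leq_card; apply/subsetP => v; rewrite !inE eo.
rewrite big_split /= flip addnn -muln2 expnS mulnC -mulnA leq_mul2l /=.
apply: (@leq_trans (\sum_(u : T) 2 ^ r)); first by apply: leq_sum => u _; exact: od.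
by rewrite sum_nat_const card_ord mulnC.
Qed.

Definition heavy q := [set u | n <= q * deg u].

Lemma card_heavy r q : 0 < n -> ~ has_K_minor r e -> #|heavy q| <= q * 2 ^ r.+1.
Proof.
move=> n0 noK; rewrite -(leq_pmul2r n0) -mulnA.
apply: leq_trans _ (leq_mul (leqnn q) (degree_sum noK)).
rewrite -sum_nat_const big_distrr /= [X in _ <= X](bigID (mem (heavy q))) /=.
by apply: leq_trans _ (leq_addr _ _); apply: leq_sum => u; rewrite inE.
Qed.

Definition nbrs_in (H : {set T}) v := [set u in H | e v u].

(** The exceptional vertices: any other vertex outside [H] sees at most [k] vertices of [H], the
    number of hubs sought. *)
Definition crowded k (H : {set T}) := [set v | (v \notin H) && (k < #|nbrs_in H v|)].

(** Group the vertices by their neighbourhood [Z] in [H]. As [Z] has more than [k] elements,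
    [few_common_nbrs] applies to [k] of them as [L] and one more as [u], and bounds each group. *)
Lemma card_crowded k (H : {set T}) : ~ has_K_minor k.+2 e -> #|crowded k H| <= 2 ^ #|H| * (k + 3).
Proof.
move=> noK; rewrite -card_powerset -sum_nat_const -sum1_card.
rewrite (partition_big (nbrs_in H) (mem (powerset H))) /=; last first.
  by move=> v _; rewrite inE; apply/subsetP => u; rewrite inE => /andP[].
apply: leq_sum => Z _; rewrite sum1_card.
have [v0 /andP[]|no] := pickP [pred v | (v \in crowded k H) && (nbrs_in H v == Z)]; last first.
  by rewrite eq_card0 // => v; have := no v; rewrite /= unfold_in.
rewrite inE => /andP[v0H kZ] /eqP eZ; rewrite eZ in kZ.
have /card_gt0P[u uZ] : 0 < #|Z| by lia.
have /card_geqP[s [us ss sZ]] : k <= #|Z :\ u|.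
  by move: kZ; rewrite (cardsD1 u) uZ; lia.
pose L := [set x in s].
have cL : #|L| = k by rewrite cardsE (card_uniqP us).
have uL : u \notin L by rewrite inE; apply/negP => /sZ; rewrite !inE eqxx.
have LZ x : x \in L -> x \in Z by rewrite inE => /sZ; rewrite !inE => /andP[].
have noL : ~ has_K_minor #|L|.+2 e by rewrite cL.
apply: (@leq_trans #|[set v in joined e L | e u v]|); last first.
  by have := few_common_nbrs e_sym e_irr noL uL; rewrite cL => /ltnW.
apply: subset_leq_card; apply/subsetP => v; rewrite unfold_in => /andP[].
rewrite inE => /andP[vH _] /eqP vZ.
have nZ x : x \in Z -> (x \in H) && e v x by rewrite -vZ inE.
rewrite !inE -!andbA; apply/and3P; split.
- by apply: contraNN vH => /sZ; rewrite inE => /andP[_ /nZ/andP[]].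
- apply/forall_inP => x /LZ /nZ/andP[_]; by rewrite e_sym.
- by have /andP[_] := nZ u uZ; rewrite e_sym.
Qed.

(** The hypothesis says that the degree sum exceeds [(k - 1/h) n]. Fewer than [k] vertices cannot
    reach this, and [k] vertices have fewer than [n / h] non-neighbours in total, which cover
    everything outside [L] that is not joined. *)
Lemma hubs_of_heavy_nbr k h (L : {set T}) : 0 < h -> #|L| <= k ->
  (k * h).-1 * n < h * \sum_(u in L) deg u ->
  #|L| = k /\ h * #|~: (L :|: joined e L)| <= n.
Proof.
move=> h0 leLk heavyL.
have le_sum : \sum_(u in L) deg u <= #|L| * n.
  by rewrite -sum_nat_const; apply: leq_sum => u _; exact: deg_le.
have cL : #|L| = k.
  apply/eqP; rewrite eqn_leq leLk leqNgt; apply/negP => ltLk.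
  have : h * (#|L| * n) <= (k * h).-1 * n by rewrite mulnA leq_mul2r; nia.
  by have := leq_mul (leqnn h) le_sum; lia.
split=> //.
have cover_non : #|~: (L :|: joined e L)| + \sum_(u in L) deg u <= k * n.
  have -> : k * n = \sum_(u in L) (n - deg u) + \sum_(u in L) deg u.
    rewrite -big_split /= -cL -sum_nat_const; apply: eq_bigr => u _.
    by rewrite subnK // deg_le.
  rewrite leq_add2r.
  apply: (@leq_trans #|\bigcup_(u in L) ~: [set v | e u v]|).
    apply: subset_leq_card; apply/subsetP => v; rewrite !inE negb_or => /andP[vL].
    rewrite vL /= negb_forall => /existsP[u]; rewrite negb_imply => /andP[uL nuv].
    by apply/bigcupP; exists u; rewrite // !inE.
  apply: (@leq_trans (\sum_(u in L) #|~: [set v | e u v]|)).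
    elim/big_rec2: _ => [|u s S _ le_S]; first by rewrite cards0.
    by apply: leq_trans (leq_card_setU _ _) _; rewrite leq_add2l.
  apply: leq_sum => u _; have := cardsC [set v | e u v]; rewrite card_ord /deg; lia.
have : h * (#|~: (L :|: joined e L)| + \sum_(u in L) deg u) <= h * (k * n).
  by rewrite leq_mul2l cover_non orbT.
move: heavyL; have [->|k0] := posnP k; first by rewrite mul0n !muln0; lia.
have -> : h * (k * n) = (k * h).-1 * n + n by rewrite mulnA [h * k]mulnC; nia.
rewrite mulnDr; lia.
Qed.

End Degrees.

(** * Spectral bound in the absence of hubs *)

Section NoHubs.
Variables (R : realType) (n : nat) (e : rel 'I_n).
Hypotheses (e_sym : symmetric e) (e_irr : irreflexive e).
Variables (k : nat) (H : {set 'I_n}).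
Local Notation X := (crowded e k H).

Definition light_arc : rel 'I_n :=
  fun u v => [&& e u v, u \in H, v \notin H & v \notin X].

(** The weight [rho / deg u] makes both ends tight: at a heavy vertex the arcs cost at most [rho],
    at a light one the degree sum of its heavy neighbours over [rho]. *)
Lemma light_arc_bound (rho : R) x : 0 < rho ->
  (forall v, v \notin H -> v \notin X ->
     (\sum_(u in nbrs_in e H v) deg e u)%:R <= rho ^+ 2) ->
  `|quad (adj R light_arc) x| *+ 2 <= rho * sqn x.
Proof.
move=> rho0 rhoP; apply: (@quad_weighted_bound _ _ _ (fun u _ => rho / (deg e u)%:R)).
  move=> u v /and4P[euv _ _ _]; rewrite divr_gt0 // ltr0n.
  by apply/card_gt0P; exists v; rewrite inE.
move=> u; have [uH|uH] := boolP (u \in H).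
  rewrite [X in _ + X]big1 ?addr0 => [|v _]; last first.
    by rewrite /adj /light_arc uH !andbF mul0r.
  rewrite sum_adj mulrC -mulrA ger_pMr // mulrC.
  have [d0|d0] := posnP (deg e u).
    by rewrite d0 invr0 mulr0 ler01.
  rewrite ler_pdivrMr ?ltr0n // mul1r ler_nat; apply: subset_leq_card.
  by apply/subsetP => v; rewrite !inE => /andP[].
rewrite [X in X + _]big1 ?add0r => [|v _]; last first.
  by rewrite /adj /light_arc (negPf uH) !andbF mul0r.
have [uX|uX] := boolP (u \in X).
  by rewrite big1 ?(ltW rho0) // => v _; rewrite /adj /light_arc uX !andbF mul0r.
rewrite -(ler_pM2r rho0) mulr_suml.
rewrite -expr2; apply: le_trans (rhoP u uH uX).
rewrite natr_sum [X in _ <= X]big_mkcond /=; apply: ler_sum => v _.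
rewrite /adj /light_arc uH uX !andbT inE [e u v]e_sym andbC.
case: (_ && _); last by rewrite mul0r mul0r.
by rewrite mul1r invf_div divfK ?gt_eqF.
Qed.

(** The edges meeting [H] that stay within the boundedly many vertices of [H] and [X]. *)
Definition dense_arc : rel 'I_n :=
  fun u v => e u v && [|| (u \in H) && (v \in H), (u \in H) && (v \in X) | (u \in X) && (v \in H)].

Lemma dense_arc_bound M x : (#|H| + #|X| <= M)%N ->
  `|quad (adj R dense_arc) x| <= M%:R * sqn x.
Proof.
move=> leM; suff : `|quad (adj R dense_arc) x| *+ 2 <= (M%:R + M%:R) * sqn x.
  by rewrite mulr2n; lra.
apply: (@quad_weighted_bound _ _ _ (fun _ _ => 1)) => // u.
have le_card (p : rel 'I_n) : (forall v, p u v -> v \in H :|: X) ->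
    (#|[set v | p u v]|%:R : R) <= M%:R.
  move=> pHX; rewrite ler_nat; apply: leq_trans leM.
  apply: leq_trans _ (leq_card_setU _ _); apply: subset_leq_card.
  by apply/subsetP => v; rewrite inE; exact: pHX.
rewrite sum_adj sum_adj_flip invr1 !mulr1 lerD //.
  by apply: le_card => v /andP[_ /or3P[]/andP[_ vH]]; rewrite in_setU vH ?orbT.
apply: (le_card (fun u v => dense_arc v u)) => v.
by move=> /andP[_ /or3P[]/andP[vH _]]; rewrite in_setU vH ?orbT.
Qed.

(** Reversing all arcs preserves a form, so the two oriented families are doubled, while [dense_arc]
    already contains both directions. *)
Lemma edge_split (o : rel 'I_n) x : (forall u v, e u v = o u v || o v u) ->
  (forall u v, ~~ (o u v && o v u)) ->
  quad (adj R e) x = quad (adj R light_arc) x *+ 2 +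
    quad (adj R (fun u v => [&& o u v, u \in ~: H & v \in ~: H])) x *+ 2 +
    quad (adj R dense_arc) x.
Proof.
move=> eo oN; rewrite !mulr2n -{2}(quad_flip (adj R light_arc)).
set po := (fun u v => [&& o u v, _ & _]); rewrite -{2}(quad_flip (adj R po)) -!quadD.
apply: eq_quad => u v; rewrite /adj /po /light_arc /dense_arc !in_setC [e v u]e_sym.
have [uH|uH] := boolP (u \in H); have [vH|vH] := boolP (v \in H); rewrite /= ?andbF ?andbT ?orbF ?orbT ?add0r ?addr0 //.
- by case: (e u v); case: (v \in X); rewrite /= ?add0r ?addr0.
- by case: (e u v); case: (u \in X); rewrite /= ?add0r ?addr0.
- have := eo u v; have := oN u v.
  by case: (o u v); case: (o v u) => //= _ ->; rewrite /= ?add0r ?addr0.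
Qed.

End NoHubs.

Lemma no_hub_bound (R : realType) n (e : rel 'I_n) k q l (rho : R) x :
  l = (q ^ 2 * 2 ^ k.+3)%N -> symmetric e -> irreflexive e -> ~ has_K_minor k.+2 e -> (0 < n)%N -> (0 < q)%N ->
  0 < rho ->
  (forall v, v \notin heavy e (q ^ 2) -> v \notin crowded e k (heavy e (q ^ 2)) ->
     (\sum_(u in nbrs_in e (heavy e (q ^ 2)) v) deg e u)%:R <= rho ^+ 2) ->
  `|quad (adj R e) x| <= (rho + (2 ^ k.+2).+1%:R / q%:R * Num.sqrt n%:R
     + (l + 2 ^ l * (k + 3))%:R) * sqn x.
Proof.
move=> def_l e_sym e_irr noK n0 q0 rho0; set H := heavy e (q ^ 2) => rhoP.
have [o [eo oN od]] := minor_free_orientation e_sym e_irr noK.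
rewrite (edge_split e_sym k H x eo oN).
have nu0 : 0 < Num.sqrt (n%:R : R) by rewrite sqrtr_gt0 ltr0n.
have nu2 : Num.sqrt (n%:R : R) ^+ 2 = n%:R by rewrite sqr_sqrtr // ler0n.
set nu := Num.sqrt _ in nu0 nu2 *.
have qR0 : 0 < q%:R :> R by rewrite ltr0n.
have B1 := light_arc_bound e_sym x rho0 rhoP.
have cardH : (#|H| <= l)%N by rewrite def_l; exact: (card_heavy e_sym e_irr (q ^ 2)%N n0 noK).
have B3 : `|quad (adj R (dense_arc e k H)) x| <= (l + 2 ^ l * (k + 3))%:R * sqn x.
  apply: dense_arc_bound; rewrite leq_add //.
  apply: leq_trans (card_crowded e_sym e_irr H noK) _.
  by rewrite leq_mul2r leq_exp2l // cardH orbT.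
have B2 : `|quad (adj R (fun u v => [&& o u v, u \in ~: H & v \in ~: H])) x| *+ 2 <=
    ((2 ^ k.+2).+1%:R / q%:R * nu) * sqn x.
  (* Outside [H] degrees are below [n / q ^ 2] and out-degrees at most [2 ^ k.+2]; [oriented_bound]
     is used with [t = nu / q]. *)
  have -> : (2 ^ k.+2).+1%:R / q%:R * nu =
      (nu / q%:R) * (2 ^ k.+2)%:R + n%:R / q%:R ^+ 2 / (nu / q%:R).
    by rewrite -nu2 -natr1; field; rewrite !gt_eqF.
  apply: oriented_bound => //; first by rewrite divr_gt0.
    move=> u; rewrite !inE -ltnNge => uH.
    rewrite ler_pdivlMr ?exprn_gt0 // -natrX -natrM ler_nat mulnC.
    apply: leq_trans (ltnW uH); rewrite leq_mul2l; apply/orP; right.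
    apply: subset_leq_card; apply/subsetP => v; rewrite !inE => /andP[_ ovu].
    by rewrite eo ovu orbT.
  by rewrite divr_ge0 ?ler0n // exprn_ge0.
rewrite !mulrDl; apply: le_trans (ler_normD _ _) _; apply: lerD => //.
by apply: le_trans (ler_normD _ _) _; rewrite !normrMn; apply: lerD.
Qed.

Lemma sqrt_sub_ge (R : realType) (k n : nat) : (k <= n)%N ->
  Num.sqrt k%:R * Num.sqrt n%:R - k%:R <= Num.sqrt (k%:R * (n%:R - k%:R)) :> R.
Proof.
move=> le_kn; set K : R := k%:R; set N : R := n%:R.
have [s2 n2] : Num.sqrt K ^+ 2 = K /\ Num.sqrt N ^+ 2 = N by rewrite !sqr_sqrtr ?ler0n.
have [s0 n0] := (sqrtr_ge0 K, sqrtr_ge0 N).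
have sn : Num.sqrt K <= Num.sqrt N by rewrite ler_sqrt ?ler0n // ler_nat.
have K0 : 0 <= K by rewrite ler0n.
have KN : K <= N by rewrite ler_nat.
have le_Ks : K <= Num.sqrt K * Num.sqrt N by rewrite -{1}s2 expr2 ler_wpM2l.
rewrite -(@ler_pXn2r _ 2) ?nnegrE ?sqrtr_ge0 ?subr_ge0 //.
rewrite sqr_sqrtr ?mulr_ge0 ?subr_ge0 // sqrrB exprMn s2 n2.
have : K * K <= K * (Num.sqrt K * Num.sqrt N) by rewrite ler_wpM2l.
by rewrite mulr2n; nra.
Qed.

(** Replacing [k] by [k - 1/h] under the root saves [sqrt n / (2 k h)], four times the middle term;
    for large [n] one such share also exceeds [M + k], where the [k] pays for passing from
    [sqrt (k n)] to [sqrt (k (n - k))]. *)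
Lemma hub_numerics (R : realType) (k h M : nat) (n : nat) : (0 < k)%N -> (1 < h)%N ->
  ((8 * k * h * (M + k)).+1 ^ 2 <= n)%N ->
  Num.sqrt ((k%:R - h%:R^-1) * n%:R) + Num.sqrt n%:R / (8 * k * h)%:R + M%:R
    < Num.sqrt (k%:R * (n%:R - k%:R)) :> R.
Proof.
move=> k0 h1 leN; set nu : R := Num.sqrt n%:R.
have nu2 : nu ^+ 2 = n%:R by rewrite sqr_sqrtr // ler0n.
have nu0 : 0 <= nu by exact: sqrtr_ge0.
have kR : 1 <= k%:R :> R by rewrite ler1n.
have hR : 2 <= h%:R :> R by rewrite ler_nat.
have MR : 0 <= M%:R :> R by rewrite ler0n.
pose K : R := k%:R; pose h' : R := h%:R; pose M' : R := M%:R.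
have nu_big : 8 * K * h' * (M' + K) < nu.
  have : ((8 * k * h * (M + k)).+1 %:R : R) ^+ 2 <= nu ^+ 2 by rewrite nu2 -natrX ler_nat.
  rewrite ler_pXn2r ?nnegrE ?ler0n //; apply: lt_le_trans.
  by rewrite -[X in _ < X]natr1 !natrM natrD -/K -/h' -/M'; lra.
pose s : R := Num.sqrt K.
have s2 : s ^+ 2 = K by rewrite sqr_sqrtr // ler0n.
have s1 : 1 <= s by rewrite -(@ler_pXn2r _ 2) ?nnegrE ?ler01 ?sqrtr_ge0 // s2 expr1n.
have sK : s <= K by rewrite -s2; nra.
have hk0 : 0 < 2 * h' * K by rewrite /h' /K; nra.
have big_enough : K <= nu.
  by apply: ltW; apply: le_lt_trans nu_big; rewrite /K /h' /M'; nra.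
have lower : s * nu - K <= Num.sqrt (K * (n%:R - K)).
  by apply: sqrt_sub_ge; rewrite -(ler_nat R) -nu2; rewrite /K in big_enough; nra.
have upper : Num.sqrt ((k%:R - h%:R^-1) * n%:R) <= s * nu - nu / (2 * h' * K).
  have -> : s * nu - nu / (2 * h' * K) = nu * (s - (2 * h' * K)^-1) by ring.
  have inv1 : (2 * h' * K)^-1 <= 1 by rewrite invf_le1 //; rewrite /h' /K; nra.
  rewrite -(@ler_pXn2r _ 2) ?nnegrE ?sqrtr_ge0 //; last first.
    by rewrite mulr_ge0 // subr_ge0; lra.
  have hinv : h'^-1 <= 1 by rewrite invf_le1 /h'; lra.
  rewrite sqr_sqrtr; last by rewrite mulr_ge0 ?ler0n // subr_ge0; rewrite /h' in hinv; lra.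
  rewrite exprMn nu2 mulrC ler_wpM2l ?ler0n // -/K -/h'.
  have -> : (s - (2 * h' * K)^-1) ^+ 2 =
      s ^+ 2 - s / K * h'^-1 + ((2 * h' * K)^-1) ^+ 2.
    by field; rewrite /h' /K; lra.
  rewrite s2.
  have : s / K * h'^-1 <= h'^-1.
    rewrite ger_pMl ?invr_gt0; last by rewrite /h'; lra.
    by rewrite ler_pdivrMr ?mul1r // /K; lra.
  by have := sqr_ge0 ((2 * h' * K)^-1); lra.
suff : nu / (8 * k * h)%:R + M%:R < nu / (2 * h' * K) - K by rewrite -/K; lra.
have c0 : 0 < 8 * K * h' by rewrite /K /h'; nra.
have -> : nu / (2 * h' * K) = 4 * (nu / (8 * K * h')).
  by field; rewrite /K /h'; lra.
rewrite !natrM -/K -/h'.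
have : M' + K < nu / (8 * K * h') by rewrite ltr_pdivlMr // mulrC.
by rewrite -/M'; rewrite /K /M' in MR *; lra.
Qed.

(** If the heavy neighbours of some light, uncrowded vertex have degree sum above [(k - 1/h) n],
    they are the hubs. Otherwise [no_hub_bound] with [rho ^ 2 = (k - 1/h) n] bounds the form
    strictly below [sqrt (k (n - k))]. *)
Lemma exists_hubs (R : realType) (k h : nat) : (0 < k)%N -> (1 < h)%N ->
  exists N, forall n, (N <= n)%N -> forall e : rel 'I_n, simple_graph e ->
    ~ has_K_minor k.+2 e ->
    (forall c : R, (forall x, `|quad (adj R e) x| <= c * sqn x) ->
       Num.sqrt (k%:R * (n%:R - k%:R)) <= c) ->
    exists L : {set 'I_n}, #|L| = k /\ (h * #|~: (L :|: joined e L)| <= n)%N.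
Proof.
(* This [q] turns the middle term of [no_hub_bound] into [sqrt n / (8 k h)]. *)
move=> k0 h1; pose q := (8 * k * h * (2 ^ k.+2).+1)%N.
pose l := (q ^ 2 * 2 ^ k.+3)%N; pose M := (l + 2 ^ l * (k + 3))%N.
exists ((8 * k * h * (M + k)).+1 ^ 2)%N => n leN e [e_sym e_irr] noK big.
have n0 : (0 < n)%N by apply: leq_trans leN; rewrite expn_gt0.
have q0 : (0 < q)%N by rewrite !muln_gt0 k0 (ltnW h1).
have c0 : (0 < 8 * k * h)%N by rewrite !muln_gt0 k0 (ltnW h1).
pose H := heavy e (q ^ 2).
have [v|no] := pickP [pred v | [&& v \notin H, v \notin crowded e k H &
    ((k * h).-1 * n < h * \sum_(u in nbrs_in e H v) deg e u)%N]].
  move=> /and3P[vH vX heavyv]; exists (nbrs_in e H v).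
  apply: hubs_of_heavy_nbr => //; first exact: ltnW.
  by move: vX; rewrite inE vH /= -leqNgt.
exfalso.
have kh : 0 < k%:R - h%:R^-1 :> R.
  have : (h%:R : R)^-1 < 1 by rewrite invf_lt1 ?ltr0n ?ltr1n // ltnW.
  have : 1 <= k%:R :> R by rewrite ler1n.
  by lra.
have := hub_numerics R k0 h1 leN; apply/negP; rewrite -leNgt.
apply: big => x.
have rho2 : Num.sqrt ((k%:R - h%:R^-1) * n%:R) ^+ 2 = (k%:R - h%:R^-1) * n%:R :> R.
  by rewrite sqr_sqrtr // mulr_ge0 ?ler0n // ltW.
have := @no_hub_bound R n e k q l (Num.sqrt ((k%:R - h%:R^-1) * n%:R)) x erefl e_sym e_irr noK n0 q0.
rewrite -/H rho2; set rho := Num.sqrt _.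
have -> : (2 ^ k.+2).+1%:R / q%:R * Num.sqrt n%:R = Num.sqrt n%:R / (8 * k * h)%:R :> R.
  by rewrite /q natrM invfM mulrCA mulfV ?pnatr_eq0 // mulr1 mulrC.
apply; first by rewrite sqrtr_gt0 mulr_gt0 // ltr0n.
move=> v vH vX; have := no v; rewrite /= vH vX /= => /negbT; rewrite -leqNgt => le_h.
have h0 : 0 < h%:R :> R by rewrite ltr0n ltnW.
rewrite -(ler_pM2l h0) -natrM mulrA mulrBr divff ?gt_eqF //.
have -> : h%:R * k%:R - 1 = (k * h).-1%:R :> R.
  by rewrite -subn1 natrB ?muln_gt0 ?k0 ?(ltnW h1) // natrM mulrC.
by rewrite -natrM ler_nat.
Qed.

(** * Joining every vertex to the hubs *)

(** By Lagrange's identity: the double sum of squares equals twice the difference of the two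
    sides. *)
Lemma cauchy_schwarz (R : realType) (I : finType) (A : pred I) (x y : I -> R) :
  (\sum_(i | A i) x i * y i) ^+ 2 <=
  (\sum_(i | A i) x i ^+ 2) * (\sum_(i | A i) y i ^+ 2).
Proof.
set X := \sum_(i | A i) x i ^+ 2; set Y := \sum_(i | A i) y i ^+ 2.
set Z := \sum_(i | A i) x i * y i.
have : 0 <= \sum_(i | A i) \sum_(j | A j) (x i * y j - x j * y i) ^+ 2.
  by apply: sumr_ge0 => i _; apply: sumr_ge0 => j _; exact: sqr_ge0.
have -> : \sum_(i | A i) \sum_(j | A j) (x i * y j - x j * y i) ^+ 2 =
  \sum_(i | A i) \sum_(j | A j) (x i ^+ 2 * y j ^+ 2 +
     ((x i * y i) * (- 2 * (x j * y j)) + y i ^+ 2 * x j ^+ 2)).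
  by apply: eq_bigr => i _; apply: eq_bigr => j _; ring.
under eq_bigr => i _ do rewrite !big_split /= -!mulr_sumr.
by rewrite !big_split /= -!mulr_suml -/X -/Y -/Z; nra.
Qed.

Section Parts.
Variables (R : realType) (n : nat) (L : {set 'I_n}).
Implicit Types (e : rel 'I_n) (x : 'I_n -> R).

Definition hub_sum e x v := \sum_(u in L) adj R e u v * x u.

Definition quad_in e x := \sum_(u in L) \sum_(v in L) adj R e u v * x u * x v.

Definition quad_out e x :=
  \sum_(u | u \notin L) \sum_(v | v \notin L) adj R e u v * x u * x v.

Lemma quad_parts e x : symmetric e -> quad (adj R e) x =
  quad_in e x + (\sum_(v | v \notin L) x v * hub_sum e x v) *+ 2 + quad_out e x.
Proof.
move=> e_sym; rewrite /quad (bigID (mem L)) /=.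
rewrite (eq_bigr (fun u => \sum_(v in L) adj R e u v * x u * x v +
   \sum_(v | v \notin L) adj R e u v * x u * x v)); last first.
  by move=> u _; rewrite (bigID (mem L)).
rewrite [X in _ + X](eq_bigr (fun u => \sum_(v in L) adj R e u v * x u * x v +
   \sum_(v | v \notin L) adj R e u v * x u * x v)); last first.
  by move=> u _; rewrite (bigID (mem L)).
rewrite !big_split /= -/(quad_in e x) -/(quad_out e x) mulr2n !addrA.
congr (_ + _ + _ + _).
  rewrite exchange_big /=; apply: eq_bigr => v _; rewrite /hub_sum mulr_sumr.
  by apply: eq_bigr => u _; ring.
apply: eq_bigr => v _; rewrite /hub_sum mulr_sumr.
by apply: eq_bigr => u _; rewrite (adjC _ e_sym v u); ring.
Qed.

Lemma quad_join e x : symmetric e -> quad (adj R (join_indep L e)) x =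
  quad_in e x + ((\sum_(v | v \notin L) x v) * \sum_(u in L) x u) *+ 2.
Proof.
move=> e_sym; rewrite quad_parts; last first.
  by move=> u v; rewrite /join_indep; case: (u \in L); case: (v \in L); rewrite //= e_sym.
rewrite [quad_out _ _]big1 ?addr0 => [|u uL]; last first.
  by rewrite big1 // => v vL; rewrite /adj /join_indep (negPf uL) (negPf vL) !mul0r.
congr (_ + _ *+ 2).
  apply: eq_bigr => u uL; apply: eq_bigr => v vL.
  by rewrite /adj /join_indep uL vL.
rewrite mulr_suml; apply: eq_bigr => v vL; congr (_ * _); apply: eq_bigr => u uL.
by rewrite /adj /join_indep uL vL mul1r.
Qed.

Lemma sqn_parts x : sqn x = \sum_(u in L) x u ^+ 2 + \sum_(v | v \notin L) x v ^+ 2.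
Proof. by rewrite /sqn (bigID (mem L)). Qed.

Lemma quad_in_bound e x : `|quad_in e x| <= #|L|%:R * sqn x.
Proof.
pose p : rel 'I_n := fun u v => [&& e u v, u \in L & v \in L].
have -> : quad_in e x = quad (adj R p) x.
  rewrite /quad_in /quad big_mkcond; apply: eq_bigr => u _.
  have [uL|uL] := boolP (u \in L); last first.
    by rewrite big1 // => v _; rewrite /adj /p (negPf uL) andbF !mul0r.
  rewrite big_mkcond; apply: eq_bigr => v _; rewrite /adj /p uL.
  by case: (v \in L); rewrite ?andbT // !andbF !mul0r.
suff : `|quad (adj R p) x| *+ 2 <= (#|L|%:R + #|L|%:R) * sqn x by rewrite mulr2n; lra.
apply: (@quad_weighted_bound _ _ _ (fun _ _ => 1)) => // u.
rewrite sum_adj sum_adj_flip invr1 !mulr1 lerD // ler_nat; apply: subset_leq_card;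
  by apply/subsetP => v; rewrite inE => /and3P[].
Qed.

(** Cutting [x] down to [T] lets later bounds involve only the mass of [x] on [T]. *)
Lemma quad_out_supp e (T : {set 'I_n}) x :
  (forall u v, e u v -> u \notin L -> v \notin L -> u \in T) -> symmetric e ->
  quad_out e x = quad (adj R (fun u v => [&& e u v, u \in ~: L & v \in ~: L]))
     (fun u => if u \in T then x u else 0).
Proof.
move=> eT e_sym; rewrite /quad_out /quad big_mkcond; apply: eq_bigr => u _; rewrite /adj.
have [uL|uL] := boolP (u \in L).
  by rewrite /= big1 // => v _; rewrite !inE uL andbF !mul0r.
rewrite big_mkcond; apply: eq_bigr => v _; rewrite !inE uL.
have [vL|vL] := boolP (v \in L); first by rewrite /= andbF !mul0r.
rewrite /= andbT; have [euv|_] := boolP (e u v); last by rewrite !mul0r.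
by rewrite (eT u v) // (eT v u) // e_sym.
Qed.

Lemma hub_sum_sq e x v : hub_sum e x v ^+ 2 <= #|L|%:R * \sum_(u in L) x u ^+ 2.
Proof.
apply: le_trans (cauchy_schwarz _ _ _) _.
rewrite ler_wpM2r ?sumr_ge0 // => [u _|]; first exact: sqr_ge0.
rewrite -sum1_card natr_sum; apply: ler_sum => u _; rewrite /adj.
by case: (e u v); rewrite ?expr1n // expr0n ler01.
Qed.

Lemma sum_out_const (c : R) : \sum_(v | v \notin L) c = #|~: L|%:R * c.
Proof. by rewrite mulr_natl -sumr_const; apply: eq_bigl => v; rewrite inE. Qed.

Lemma cross_bound e x : (\sum_(v | v \notin L) x v * hub_sum e x v) ^+ 2 <=
  n%:R * #|L|%:R * (\sum_(u in L) x u ^+ 2) * (\sum_(v | v \notin L) x v ^+ 2).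
Proof.
apply: le_trans (cauchy_schwarz _ _ _) _.
rewrite mulrC ler_wpM2r ?sumr_ge0 // => [u _|]; first exact: sqr_ge0.
apply: (@le_trans _ _ (\sum_(v | v \notin L) #|L|%:R * \sum_(u in L) x u ^+ 2)).
  by apply: ler_sum => v _; exact: hub_sum_sq.
rewrite sum_out_const mulrA ler_wpM2r ?sumr_ge0 // => [u _|]; first exact: sqr_ge0.
by rewrite ler_wpM2r ?ler0n // ler_nat -[X in (_ <= X)%N](card_ord n) max_card.
Qed.

End Parts.

(** * The sparse graph outside the hubs *)

Section Outside.
Local Open Scope nat_scope.
Variables (n : nat) (e : rel 'I_n) (L : {set 'I_n}).
Hypotheses (e_sym : symmetric e) (e_irr : irreflexive e).
Hypotheses (noK : ~ has_K_minor #|L|.+2 e) (room : #|L| + 3 <= #|joined e L|).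

Definition unjoined := ~: (L :|: joined e L).

Definition out_support := [set v | (v \notin L) && [exists w, (w \notin L) && e v w]].

Lemma out_supportP u v : e u v -> u \notin L -> v \notin L -> u \in out_support.
Proof. by move=> euv uL vL; rewrite inE uL; apply/existsP; exists v; rewrite vL. Qed.

Lemma notin_split v : v \notin L -> (v \in joined e L) || (v \in unjoined).
Proof. by move=> vL; rewrite !inE (negPf vL) /=; case: [forall u in L, e u v]. Qed.

(** Besides unjoined vertices, [v] has at most one joined neighbour, by [joined_nbr_unique]; this is
    the extra 1. *)
Lemma out_degree v : v \notin L -> #|[set w in ~: L | e w v]| <= #|unjoined|.+1.
Proof.
move=> vL; apply: (@leq_trans #|unjoined :|: [set w in joined e L | e v w]|).
  apply: subset_leq_card; apply/subsetP => w; rewrite in_set in_setC => /andP[wL ewv].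
  by case/orP: (notin_split wL) => wJ; apply/setUP; [right; rewrite in_set wJ e_sym|left].
apply: leq_trans (leq_card_setU _ _) _; rewrite -addn1 leq_add2l.
rewrite leqNgt; apply/negP => /card_gt1P[a [b [aC bC]]]; apply/negP; rewrite negbK.
move: aC bC; rewrite in_set => /andP[aJ va]; rewrite in_set => /andP[bJ vb].
by apply/eqP; exact: (joined_nbr_unique e_sym e_irr noK room vL).
Qed.

(** Send a joined vertex of the support to a chosen neighbour outside [L]. The image is unjoined by
    [joined_independent], and the map is injective by [joined_nbr_unique]. *)
Lemma card_out_support : #|out_support| <= 2 * #|unjoined|.
Proof.
pose f v := odflt v [pick w | (w \notin L) && e v w].
have fP v : v \in out_support -> f v \notin L /\ e v (f v).
  rewrite inE => /andP[_ /existsP[w wP]]; rewrite /f; case: pickP => [z /andP[]//|/(_ w)].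
  by rewrite wP.
have sub : out_support \subset unjoined :|: (out_support :&: joined e L).
  apply/subsetP => v vT; rewrite in_setU in_setI vT /= orbC notin_split //.
  by move: vT; rewrite inE => /andP[].
apply: leq_trans (subset_leq_card sub) _; apply: leq_trans (leq_card_setU _ _) _.
rewrite mul2n -addnn leq_add2l -(card_in_imset (f := f)).
  apply: subset_leq_card; apply/subsetP => _ /imsetP[v /setIP[vT vJ] ->].
  have [fL evf] := fP v vT; have := notin_split fL; case/orP => // fJ.
  by have := joined_independent e_sym e_irr noK room vJ fJ; rewrite evf.
move=> v w /setIP[vT vJ] /setIP[wT wJ] eq_f.
have [fL evf] := fP v vT; have [_ ewf] := fP w wT.
apply: (joined_nbr_unique e_sym e_irr noK room fL) => //; rewrite e_sym //.
by rewrite eq_f.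
Qed.

Lemma quad_out_bound (R : realType) (t : R) (x : 'I_n -> R) : (0 < t)%R ->
  (`|quad_out L e x| <= (t * (2 ^ #|L|.+2)%:R + #|unjoined|.+1%:R / t) *
     \sum_(v in out_support) x v ^+ 2)%R.
Proof.
move=> t0; have [o [eo oN od]] := minor_free_orientation e_sym e_irr noK.
rewrite (quad_out_supp x out_supportP e_sym).
set x' := (fun u => if _ then _ else _).
pose po u v := [&& o u v, u \in ~: L & v \in ~: L].
have -> : quad (adj R (fun u v => [&& e u v, u \in ~: L & v \in ~: L])) x' =
    (quad (adj R po) x' *+ 2)%R.
  rewrite mulr2n -[X in (_ + X)%R]quad_flip -quadD; apply: eq_quad => u v.
  rewrite /adj /po eo; have := oN u v.
  case: (o u v); case: (o v u); case: (u \in ~: L); case: (v \in ~: L) => //= _;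
    by rewrite ?add0r ?addr0.
have -> : (\sum_(v in out_support) x v ^+ 2 = sqn x')%R.
  rewrite /sqn big_mkcond; apply: eq_bigr => v _; rewrite /x'.
  by case: ifP => // _; rewrite expr0n.
rewrite normrMn; apply: oriented_bound => //.
move=> u uL; rewrite ler_nat; rewrite inE in uL; apply: leq_trans (out_degree uL).
apply: subset_leq_card; apply/subsetP => v; rewrite !inE => /andP[-> ovu].
by rewrite eo ovu.
Qed.

End Outside.

(** * Improving an extreme eigenvector *)

Section Improve.
Variables (R : realType) (n : nat) (e : rel 'I_n) (L : {set 'I_n}).
Hypotheses (e_sym : symmetric e) (e_irr : irreflexive e).
Hypotheses (noK : ~ has_K_minor #|L|.+2 e) (room : (#|L| + 3 <= #|joined e L|)%N).
Local Notation T := (out_support e L).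
Local Notation m := (#|unjoined e L|%:R : R).
Local Notation K := (#|L|%:R : R).
(** [nu] is [sqrt n], [gamma] a small constant depending only on the number of hubs, and [g] bounds
    the form outside the hubs. The eigenvalue is [sigma * rho], so the sign [sigma] treats both ends
    of the spectrum at once. *)
Variables (nu gamma g rho sigma : R).
Hypotheses (K1 : 1 <= K) (nu0 : 0 < nu) (nu2 : nu ^+ 2 = n%:R)
  (gammaE : gamma * (300 * K ^+ 3) = 1)
  (g0 : 0 <= g) (g_small : g <= gamma * nu)
  (out_bound : forall x, `|quad_out L e x| <= g * \sum_(v in T) x v ^+ 2)
  (m_small : m + K <= gamma ^+ 2 * nu ^+ 2) (K_small : K <= gamma * nu)
  (rho_big : Num.sqrt K * nu - 4 * gamma * nu <= rho)
  (sigma1 : sigma = 1 \/ sigma = -1).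

Lemma gamma_gt0 : 0 < gamma.
Proof.
have K3 : 0 < 300 * K ^+ 3 by have := exprn_gt0 3 (lt_le_trans ltr01 K1); lra.
by rewrite -(pmulr_lgt0 _ K3) gammaE ltr01.
Qed.

Lemma gamma_le c : 0 <= c <= 300 * K ^+ 3 -> gamma * c <= 1.
Proof. by move=> /andP[c0 cK]; rewrite -gammaE ler_wpM2l // ltW // gamma_gt0. Qed.

Lemma K_pow : K <= K ^+ 2 <= K ^+ 3.
Proof.
have K0 : 0 <= K by rewrite ler0n.
have k1 := K1.
by rewrite {1}expr2 [K ^+ 3]exprS !ler_peMl ?exprn_ge0.
Qed.

Lemma sqrtK : [/\ 1 <= Num.sqrt K, Num.sqrt K <= K & Num.sqrt K ^+ 2 = K].
Proof.
have s2 : Num.sqrt K ^+ 2 = K by rewrite sqr_sqrtr // ler0n.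
by have k1 := K1; have s0 := sqrtr_ge0 K; split=> //; nra.
Qed.

Lemma norm_sigma a : `|sigma * a| = `|a|.
Proof. by case: sigma1 => ->; rewrite ?mul1r // mulN1r normrN. Qed.

Section Eigenvector.
Variable y : 'I_n -> R.
Hypotheses (y1 : sqn y = 1) (ey : forall i, \sum_j adj R e i j * y j = sigma * rho * y i).
Local Notation a2 := (\sum_(u in L) y u ^+ 2).
Local Notation b2 := (\sum_(v | v \notin L) y v ^+ 2).
Local Notation P := (\sum_(v | v \notin L) y v * hub_sum L e y v).

Lemma a2_ge0 : 0 <= a2. Proof. by apply: sumr_ge0 => u _; exact: sqr_ge0. Qed.
Lemma b2_ge0 : 0 <= b2. Proof. by apply: sumr_ge0 => u _; exact: sqr_ge0. Qed.
Lemma ab1 : a2 + b2 = 1. Proof. by rewrite -(sqn_parts L) y1. Qed.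

Lemma out_mass_le : \sum_(v in T) y v ^+ 2 <= 1.
Proof.
rewrite -y1 /sqn [X in _ <= X](bigID (mem T)) /= lerDl.
by apply: sumr_ge0 => u _; exact: sqr_ge0.
Qed.

Lemma rho_parts : rho = sigma * quad_in L e y + sigma * P *+ 2 + sigma * quad_out L e y.
Proof.
have := quad_eigen ey; rewrite y1 (quad_parts L y e_sym) mulr1 => E.
by case: sigma1 => s; move: E; rewrite s; lra.
Qed.

(** If [a2 * b2 < 1/16], then [cross_bound] gives [|P| <= sqrt K * nu / 4], so [rho] is at most
    about [sqrt K * nu / 2], against [rho_big]. *)
Lemma hub_mass : 1 / 16 <= a2 /\ 1 / 16 <= b2.
Proof.
have a0 := a2_ge0; have b0 := b2_ge0; have ab := ab1.
suff : 1 / 16 <= a2 * b2.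
  by move=> H; split; nra.
rewrite leNgt; apply/negP => small.
have [s1 sK s2] := sqrtK.
have gq : gamma * 300 <= 1 by apply: gamma_le; have k1 := K1; have /andP[] := K_pow; lra.
have Pb : `|P| <= Num.sqrt K * nu / 4.
  rewrite -(@ler_pXn2r _ 2) ?nnegrE //; last by rewrite divr_ge0 // mulr_ge0 ?sqrtr_ge0 // ltW.
  rewrite real_normK ?num_real //; apply: le_trans (cross_bound L e y) _.
  rewrite -nu2 expr_div_n exprMn s2 -mulrA.
  have : 0 <= nu ^+ 2 * K by rewrite mulr_ge0 ?sqr_ge0 //; lra.
  by set c := nu ^+ 2 * K; rewrite [K * _]mulrC -/c => c0; nra.
have in_le := quad_in_bound L e y; rewrite y1 mulr1 in in_le.
have out_le := le_trans (out_bound y) (ler_wpM2l g0 out_mass_le).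
have := rho_parts; move: (ler_norm (sigma * quad_in L e y)) (ler_norm (sigma * P)).
move: (ler_norm (sigma * quad_out L e y)); rewrite !norm_sigma => l1 l2 l3.
rewrite mulr2n; have gn := gamma_gt0.
have n1 := nu0; have r1 := rho_big; have k1 := K_small; have g1 := g_small.
nra.
Qed.

Lemma rho_large : nu / 2 <= rho - g.
Proof.
have [s1 sK s2] := sqrtK.
have gq : gamma * 300 <= 1 by apply: gamma_le; have k1 := K1; have /andP[] := K_pow; lra.
have n1 := nu0; have r1 := rho_big; have k1 := K_small; have g1 := g_small.
by nra.
Qed.

(** In the difference of the eigenvalue equations at [u] and [v] all joined vertices cancel. At most
    [m + K] terms remain, so by Cauchy-Schwarz [rho * |y u - y v| <= gamma * nu], while
    [rho >= nu / 2]. *)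
Lemma hubs_close u v : u \in L -> v \in L -> `|y u - y v| <= 2 * gamma.
Proof.
move=> uL vL; have g1 := gamma_gt0.
have rl := rho_large; have n1 := nu0; have h0 := g0; have rho0 : 0 < rho by lra.
have E : sigma * rho * (y u - y v) =
    \sum_(j in ~: joined e L) (adj R e u j - adj R e v j) * y j.
  rewrite mulrBr -!ey -sumrB [LHS](bigID (mem (joined e L))) /=.
  rewrite big1 ?add0r => [|j jJ]; last first.
    by rewrite /adj !(joinedP jJ) // subrr.
  by apply: eq_big => [j|j _]; rewrite ?inE // mulrBl.
have sq : (rho * (y u - y v)) ^+ 2 <= gamma ^+ 2 * nu ^+ 2.
  apply: le_trans m_small.
  have -> : (rho * (y u - y v)) ^+ 2 = (sigma * rho * (y u - y v)) ^+ 2.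
    by case: sigma1 => ->; rewrite ?mul1r // !mulN1r mulNr sqrrN.
  rewrite E; apply: le_trans (cauchy_schwarz _ _ _) _.
  rewrite -[X in _ <= X]mulr1; apply: ler_pM.
  - by apply: sumr_ge0 => j _; exact: sqr_ge0.
  - by apply: sumr_ge0 => j _; exact: sqr_ge0.
  - apply: (@le_trans _ _ (\sum_(j in ~: joined e L) 1)).
      apply: ler_sum => j _; rewrite /adj; case: (e u j); case: (e v j);
        by rewrite ?subrr ?sub0r ?subr0 ?sqrrN ?expr1n ?expr0n ?ler01.
    rewrite sumr_const -natrD ler_nat.
    have -> : ~: joined e L = unjoined e L :|: L.
      apply/setP => j; rewrite /unjoined !inE; case: (j \in L) => //=.
      by rewrite orbF.
    exact: leq_card_setU.
  - rewrite -y1 /sqn [X in _ <= X](bigID (mem (~: joined e L))) /= lerDl.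
    by apply: sumr_ge0 => j _; exact: sqr_ge0.
have : rho * `|y u - y v| <= gamma * nu.
  rewrite -(@ler_pXn2r _ 2) ?nnegrE ?mulr_ge0 ?(ltW rho0) ?(ltW g1) ?(ltW nu0) //.
  by move: sq; rewrite !exprMn real_normK ?num_real.
have := normr_ge0 (y u - y v); set d := `|_|; move=> d0 le_d.
have : nu / 2 * d <= gamma * nu.
  by apply: le_trans le_d; rewrite ler_wpM2r //; lra.
have -> : gamma * nu = nu / 2 * (2 * gamma) by field.
by rewrite ler_pM2l // divr_gt0.
Qed.

Lemma exists_big_hub : exists2 u, u \in L & 1 / (4 * K) <= `|y u|.
Proof.
have [a16 _] := hub_mass.
have k1 := K1; have K0 : 0 < 4 * K by lra.
have [u /andP[uL yu]|no] := pickP [pred u in L | 1 / (4 * K) <= `|y u|].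
  by exists u.
exfalso; move: a16; apply/negP; rewrite -ltNge.
have lt_u u : u \in L -> y u ^+ 2 <= (1 / (4 * K)) ^+ 2.
  move=> uL; have := no u; rewrite /= uL /= => /negbT; rewrite -ltNge => /ltW yu.
  by rewrite -(real_normK (num_real (y u))) ler_pXn2r ?nnegrE // divr_ge0 // ltW.
have L0 : (0 < #|L|)%N by rewrite -(ltr_nat R); lra.
have /card_gt0P[u0 u0L] := L0.
have lt_u0 : y u0 ^+ 2 < (1 / (4 * K)) ^+ 2.
  have := no u0; rewrite /= u0L /= => /negbT; rewrite -ltNge => yu.
  by rewrite -(real_normK (num_real (y u0))) ltr_pXn2r ?nnegrE // divr_ge0 // ltW.
apply: (@lt_le_trans _ _ (\sum_(u in L) (1 / (4 * K)) ^+ 2)).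
  rewrite (bigD1 u0) //= [X in _ < X](bigD1 u0) //= ltr_leD //.
  by apply: ler_sum => u /andP[uL _]; exact: lt_u.
have -> : \sum_(u in L) (1 / (4 * K)) ^+ 2 = 1 / (16 * K).
  by rewrite sumr_const -mulr_natl; field; lra.
by rewrite !div1r lef_pV2 ?posrE; lra.
Qed.


Variable u0 : 'I_n.
Hypotheses (u0L : u0 \in L) (yu0 : 1 / (4 * K) <= y u0) (m0 : 0 < m).
Local Notation c0 := (1 / (8 * K)).
Local Notation s := (\sum_(u in L) y u).
Local Notation w := (#|~: L|%:R : R).
Local Notation YT := (\sum_(v in T) y v ^+ 2).

Lemma c0_gt0 : 0 < c0.
Proof. by have k1 := K1; rewrite divr_gt0 //; lra. Qed.

(** [y u0] is at least [2 c0], and [hubs_close] costs at most [2 gamma <= c0]. *)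
Lemma hub_ge u : u \in L -> c0 <= y u.
Proof.
move=> uL; have := hubs_close u0L uL; rewrite ler_norml => /andP[_].
have k1 := K1; have y0 := yu0.
have : gamma * (16 * K) <= 1 by apply: gamma_le; have /andP[] := K_pow; lra.
have -> : gamma * (16 * K) = (2 * gamma) / c0 by field; lra.
rewrite ler_pdivrMr ?c0_gt0 // mul1r.
have c4 : 1 / (4 * K) = 2 * c0 by field; lra.
by move: y0; rewrite c4; lra.
Qed.

Lemma hub_le u : u \in L -> y u <= 1.
Proof.
move=> uL; apply: le_trans (ler_norm _) _.
rewrite -(@ler_pXn2r _ 2) ?nnegrE // real_normK ?num_real // expr1n -y1 /sqn (bigD1 u) //=.
by rewrite lerDl; apply: sumr_ge0 => j _; exact: sqr_ge0.
Qed.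

Lemma hub_ge0 u : u \in L -> 0 <= y u.
Proof. by move=> uL; apply: le_trans (ltW c0_gt0) (hub_ge uL). Qed.

Lemma s_ge : c0 <= s.
Proof.
rewrite (bigD1 u0) //=; apply: le_trans (hub_ge u0L) _; rewrite lerDl.
by apply: sumr_ge0 => u /andP[uL _]; exact: hub_ge0.
Qed.

Lemma s_le : s <= K.
Proof. by rewrite -sumr_const; apply: ler_sum => u; exact: hub_le. Qed.

Lemma hub_sum_ge0 v : 0 <= hub_sum L e y v.
Proof. by apply: sumr_ge0 => u uL; rewrite mulr_ge0 ?ler0n ?hub_ge0. Qed.

Lemma hub_sum_le v : hub_sum L e y v <= s.
Proof.
apply: ler_sum => u uL; rewrite /adj; case: (e u v); rewrite ?mul1r // mul0r.
exact: hub_ge0.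
Qed.

Lemma hub_sum_unjoined v : v \in unjoined e L -> hub_sum L e y v <= s - c0.
Proof.
rewrite !inE negb_or => /andP[vL]; rewrite vL /= negb_forall => /existsP[u].
rewrite negb_imply => /andP[uL /negPf nuv].
rewrite /hub_sum (bigD1 u) //= [X in _ <= X - _](bigD1 u) //= /adj nuv mul0r add0r.
have : c0 <= y u by exact: hub_ge.
suff : \sum_(i in L | i != u) (e i v)%:R * y i <= \sum_(i in L | i != u) y i by lra.
apply: ler_sum => i /andP[iL _]; case: (e i v); rewrite ?mul1r // mul0r.
exact: hub_ge0.
Qed.

(** At an unjoined vertex with hub sum [h], a missing hub entry gives [s - h >= c0], hence
    [s ^ 2 - h ^ 2 >= c0 * s]. *)
Lemma hub_sum_total : \sum_(v | v \notin L) hub_sum L e y v ^+ 2 <= w * s ^+ 2 - m * (c0 * s).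
Proof.
rewrite -sum_out_const lerBrDr addrC -lerBrDr -sumrB.
rewrite [X in _ <= X](bigID (mem (unjoined e L))) /=.
apply: (@le_trans _ _ (\sum_(v | (v \notin L) && (v \in unjoined e L)) c0 * s)).
  rewrite mulr_natl -sumr_const le_eqVlt; apply/orP; left; apply/eqP/eq_bigl => v.
  by rewrite !inE; case: (v \in L).
have c1 := c0_gt0; have s1 := s_ge.
apply: ler_wpDr.
  apply: sumr_ge0 => v _; rewrite subr_ge0 ler_pXn2r ?nnegrE ?hub_sum_ge0 ?hub_sum_le //.
  by lra.
apply: ler_sum => v /andP[_ vU].
have h0 := hub_sum_ge0 v; have h1 := hub_sum_unjoined vU.
by move: c1 s1 h0 h1; move: (hub_sum _ _ _ _) c0 s => h c t; nra.
Qed.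

Lemma w_bounds : 0 < w /\ w <= nu ^+ 2.
Proof.
split.
  rewrite ltr0n; apply: leq_trans (_ : #|joined e L| <= _)%N.
    by apply: leq_trans room; rewrite addn3.
  apply: subset_leq_card; apply/subsetP => v /joined_notin.
  by rewrite inE.
by rewrite nu2 ler_nat -[X in (_ <= X)%N](card_ord n) max_card.
Qed.

(* The deficit comes from the vertices at which [hub_sum] misses a hub. *)
Lemma cross_deficit :
  sigma * P <= Num.sqrt b2 * s * Num.sqrt w - m * c0 / (8 * nu).
Proof.
have [w0 w_le] := w_bounds; have c1 := c0_gt0; have s1 := s_ge.
have [_ b16] := hub_mass; have n1 := nu0; have m1 := m0.
set b := Num.sqrt b2; set r := Num.sqrt w.
have bb : b ^+ 2 = b2 by rewrite sqr_sqrtr // b2_ge0.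
have rr : r ^+ 2 = w by rewrite sqr_sqrtr // ltW.
have r0 : 0 < r by rewrite sqrtr_gt0.
have b4 : 1 / 4 <= b.
  rewrite -(@ler_pXn2r _ 2) ?nnegrE ?sqrtr_ge0 //; last by lra.
  by rewrite bb; lra.
have r_le : r <= nu.
  by rewrite -(@ler_pXn2r _ 2) ?nnegrE ?sqrtr_ge0 // ?(ltW n1) // rr.
have P2 : P ^+ 2 <= (b * s * r) ^+ 2 - b ^+ 2 * (m * (c0 * s)).
  apply: le_trans (cauchy_schwarz _ _ _) _.
  rewrite -bb !exprMn rr -mulrA -mulrBr [s ^+ 2 * w]mulrC.
  by rewrite ler_wpM2l ?sqr_ge0 // hub_sum_total.
apply: le_trans (ler_norm _) _; rewrite norm_sigma //.
set dlt := m * c0 / (8 * nu).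
have d0 : 0 < dlt by rewrite divr_gt0 ?mulr_gt0 //; lra.
(* With [D = b * s * r] this gives [P ^ 2 <= (D - dlt) ^ 2]; it holds as [r <= nu <= 4 b nu].
   Extracting the root also needs [dlt <= D], obtained below from [0 <= P ^ 2]. *)
have key : 2 * (b * s * r) * dlt <= b ^+ 2 * (m * (c0 * s)).
  have -> : b ^+ 2 * (m * (c0 * s)) = 2 * (b * s * (4 * b * nu)) * dlt.
    by rewrite /dlt; field; rewrite !gt_eqF //; have k1 := K1; lra.
  rewrite ler_wpM2r ?(ltW d0) // ler_wpM2l // ler_wpM2l //.
    by rewrite mulr_ge0 //; lra.
  by apply: le_trans r_le _; rewrite ler_peMl ?(ltW n1) //; lra.
have D0 : 0 < b * s * r by rewrite !mulr_gt0 //; lra.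
set D := b * s * r in P2 key D0 *.
have dD : dlt <= D.
  have := sqr_ge0 P => PP.
  have : 2 * D * dlt <= D * D by rewrite -expr2; lra.
  by rewrite [2 * D]mulrC -mulrA ler_pM2l //; lra.
rewrite -(@ler_pXn2r _ 2) ?nnegrE ?subr_ge0 // real_normK ?num_real //.
have := sqr_ge0 dlt; rewrite sqrrB => dd.
by rewrite mulr2n; lra.
Qed.

(* On [T] the eigenvalue equation reads [(sigma rho - A_T) y = hub_sum], where
   [A_T] has norm at most [g], well below [rho]. *)
Lemma out_mass_small : YT <= 8 * m * K ^+ 2 / nu ^+ 2.
Proof.
have rl := rho_large; have n1 := nu0; have h0 := g0.
pose Z := \sum_(v in T) y v * hub_sum L e y v.
(* The eigenvalue equation at each [v] in [T] is multiplied by [y v] and summed; edges outside [L]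
   start only in [T]. *)
have E : sigma * rho * YT = Z + quad_out L e y.
  have -> : quad_out L e y = \sum_(v in T) \sum_(j | j \notin L) adj R e v j * y v * y j.
    rewrite /quad_out big_mkcond [RHS]big_mkcond; apply: eq_bigr => v _.
    rewrite inE; have [vL|vL] //= := boolP (v \notin L).
    case: existsP => [//|no]; rewrite big1 // => j jL; rewrite /adj.
    have [evj|_] := boolP (e v j); last by rewrite !mul0r.
    by case: no; exists j; rewrite jL.
  rewrite mulr_sumr -big_split; apply: eq_bigr => v _ /=.
  rewrite expr2 mulrA -ey (bigID (mem L)) /= mulrDl /hub_sum mulr_suml mulr_sumr mulr_suml.
  congr (_ + _); apply: eq_bigr => j _; last by ring.
  by rewrite adjC //; ring.
have Y0 : 0 <= YT by apply: sumr_ge0 => v _; exact: sqr_ge0.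
have Z2 : Z ^+ 2 <= YT * (2 * m * K ^+ 2).
  apply: le_trans (cauchy_schwarz _ _ _) _; rewrite ler_wpM2l //.
  apply: (@le_trans _ _ (\sum_(v in T) K ^+ 2)).
    apply: ler_sum => v _; rewrite ler_pXn2r ?nnegrE ?hub_sum_ge0 ?ler0n //.
    exact: le_trans (hub_sum_le v) s_le.
  have -> : \sum_(v in T) K ^+ 2 = #|T|%:R * K ^+ 2 by rewrite sumr_const mulr_natl.
  rewrite ler_wpM2r ?sqr_ge0 // -natrM ler_nat.
  exact: card_out_support.
have small : (rho - g) * YT <= `|Z|.
  have := out_bound y; rewrite -/YT.
  have : rho * YT = sigma * Z + sigma * quad_out L e y.
    by rewrite -mulrDr -E; case: sigma1 => ->; ring.
  move: (ler_norm (sigma * Z)) (ler_norm (sigma * quad_out L e y)).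
  by rewrite !norm_sigma // mulrBl; lra.
have [Y1|Y1] := eqVneq YT 0.
  by rewrite Y1 divr_ge0 ?sqr_ge0 // mulr_ge0 ?sqr_ge0 // mulr_ge0 ?ler0n.
have {}Y1 : 0 < YT by rewrite lt_neqAle eq_sym Y1.
rewrite ler_pdivlMr ?exprn_gt0 //.
have : (nu / 2 * YT) ^+ 2 <= YT * (2 * m * K ^+ 2).
  apply: le_trans Z2; rewrite -[Z ^+ 2](real_normK (num_real _)).
  rewrite ler_pXn2r ?nnegrE ?mulr_ge0 ?invr_ge0 ?(ltW n1) //.
  by apply: le_trans small; rewrite ler_wpM2r.
have -> : (nu / 2 * YT) ^+ 2 = YT * (YT * nu ^+ 2 / 4) by field.
by rewrite ler_pM2l //; lra.
Qed.

Lemma improved_vector : exists x, sqn x = 1 /\ rho < sigma * quad (adj R (join_indep L e)) x.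
Proof.
have [w0 w_le] := w_bounds; have n1 := nu0; have m1 := m0; have k1 := K1.
set b := Num.sqrt b2; set r := Num.sqrt w.
have bb : b ^+ 2 = b2 by rewrite sqr_sqrtr // b2_ge0.
have rr : r ^+ 2 = w by rewrite sqr_sqrtr // ltW.
have r0 : 0 < r by rewrite sqrtr_gt0.
have ss : sigma ^+ 2 = 1 by case: sigma1 => ->; rewrite ?sqrrN expr1n.
(* The constant keeps the mass [b ^ 2] outside [L], and its sign makes the cross term contribute
   positively after multiplication by [sigma]. *)
exists (fun i => if i \in L then y i else sigma * b / r); split.
  rewrite -ab1 (sqn_parts L); congr (_ + _).
    by apply: eq_bigr => u ->.
  rewrite -bb (eq_bigr (fun=> (sigma * b / r) ^+ 2)) => [|v /negPf->//].
  rewrite sum_out_const -rr !exprMn ss exprVn; field; exact: lt0r_neq0.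
rewrite quad_join // (eq_bigr (fun=> sigma * b / r)) => [|v /negPf->//].
rewrite sum_out_const -rr.
have -> : \sum_(u in L) (if u \in L then y u else sigma * b / r) = s.
  by apply: eq_bigr => u ->.
have -> : quad_in L e (fun i => if i \in L then y i else sigma * b / r) = quad_in L e y.
  by apply: eq_bigr => u uL; apply: eq_bigr => v vL; rewrite uL vL.
have -> : sigma * (quad_in L e y + (r ^+ 2 * (sigma * b / r) * s) *+ 2) =
   sigma * quad_in L e y + sigma ^+ 2 * (b * s * r) *+ 2.
  by field; exact: lt0r_neq0.
rewrite ss mul1r rho_parts.
have cd := cross_deficit; rewrite -/b -/r in cd.
have loss : sigma * quad_out L e y <= 8 * gamma * K ^+ 2 * m / nu.
  apply: le_trans (ler_norm _) _; rewrite norm_sigma //.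
  apply: le_trans (out_bound y) _.
  apply: (@le_trans _ _ (gamma * nu * (8 * m * K ^+ 2 / nu ^+ 2))).
    have Y0 : 0 <= YT by apply: sumr_ge0 => v _; exact: sqr_ge0.
    by apply: ler_pM => //; exact: out_mass_small.
  by rewrite le_eqVlt; apply/orP; left; apply/eqP; field; rewrite gt_eqF.
(* The gain is [m / (32 K nu)]. With [gamma = 1 / (300 K ^ 3)] the loss is at most 256/300 of it,
   which fixes the constant 300. *)
have gain : 8 * gamma * K ^+ 2 * m / nu < (m * c0 / (8 * nu)) *+ 2.
  have -> : (m * c0 / (8 * nu)) *+ 2 = (m / nu) * (1 / (32 * K)).
    by field; rewrite gt_eqF //=; lra.
  have -> : 8 * gamma * K ^+ 2 * m / nu = (m / nu) * (8 * gamma * K ^+ 2).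
    by field; rewrite gt_eqF.
  rewrite ltr_pM2l ?divr_gt0 // ltr_pdivlMr; last by lra.
  have -> : 8 * gamma * K ^+ 2 * (32 * K) = 256 / 300 * (gamma * (300 * K ^+ 3)) by field.
  by rewrite gammaE; lra.
by move: gain cd loss; rewrite !mulr2n; lra.
Qed.

End Eigenvector.

(** Passing to [- y] if necessary makes the large hub entry positive, as [improved_vector]
    assumes. *)
Lemma eigenvector_improved (y : 'I_n -> R) : sqn y = 1 ->
  (forall i, \sum_j adj R e i j * y j = sigma * rho * y i) -> 0 < m ->
  exists x, sqn x = 1 /\ rho < sigma * quad (adj R (join_indep L e)) x.
Proof.
move=> y1 ey m0; have [u uL yu] := exists_big_hub y1 ey.
have [yu0|yu0] := leP 0 (y u).
  by apply: (improved_vector y1 ey uL) => //; rewrite -(ger0_norm yu0).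
apply: (@improved_vector (fun i => -1 * y i) _ _ u) => //.
- by rewrite sqnZ y1 mulr1 sqrrN expr1n.
- move=> i; rewrite mulrCA -ey mulr_sumr.
  by apply: eq_bigr => j _; ring.
- by rewrite mulN1r -(ltr0_norm yu0).
Qed.

End Improve.

(** * Comparison of spreads and conclusion *)

Lemma exists_set_of_card n k : (k <= n)%N -> exists L : {set 'I_n}, #|L| = k.
Proof.
rewrite -[X in (_ <= X)%N](card_ord n) => /card_geqP[s [us ss _]].
by exists [set x in s]; rewrite cardsE (card_uniqP us).
Qed.

Lemma complete_bipartite_spread (R : realType) n (L : {set 'I_n}) (a b : R) :
  (0 < #|L| < n)%N ->
  (forall x, quad (adj R (join_indep L (fun _ _ => false))) x <= a * sqn x) ->
  (forall x, - quad (adj R (join_indep L (fun _ _ => false))) x <= b * sqn x) ->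
  Num.sqrt (#|L|%:R * (n%:R - #|L|%:R)) *+ 2 <= a + b.
Proof.
move=> /andP[k0 kn] ha hb; set K : R := #|L|%:R; set w : R := n%:R - K.
have wE : w = #|~: L|%:R.
  have : n%:R = K + #|~: L|%:R :> R by rewrite -natrD cardsC card_ord.
  by rewrite /w => ->; rewrite addrC addKr.
have K0 : 0 < K by rewrite ltr0n.
have w0 : 0 < w by rewrite subr_gt0 ltr_nat.
(* At [t = 1] and [t = -1] these are the eigenvectors of the complete bipartite graph for its two
   nonzero eigenvalues. *)
pose x t i : R := if i \in L then Num.sqrt w else t * Num.sqrt K.
have [sK sw] : Num.sqrt K ^+ 2 = K /\ Num.sqrt w ^+ 2 = w.
  by rewrite !sqr_sqrtr // ltW.
have x_sqn t : sqn (x t) = K * w + w * (t ^+ 2 * K).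
  rewrite (sqn_parts L) (eq_bigr (fun=> w)) => [|u uL]; last by rewrite /x uL sw.
  rewrite [X in _ + X](eq_bigr (fun=> t ^+ 2 * K)) => [|u /negPf uL]; last first.
    by rewrite /x uL exprMn sK.
  by rewrite sum_out_const -wE sumr_const mulr_natl.
have x_quad t : quad (adj R (join_indep L (fun _ _ => false))) (x t) =
    t * (Num.sqrt (K * w) * (2 * K * w)).
  rewrite quad_join // /quad_in big1 ?add0r => [|u _]; last first.
    by rewrite big1 // => v _; rewrite /adj !mul0r.
  rewrite (eq_bigr (fun=> t * Num.sqrt K)) => [|u /negPf uL]; last by rewrite /x uL.
  rewrite [X in _ * X](eq_bigr (fun=> Num.sqrt w)) => [|u uL]; last by rewrite /x uL.
  rewrite sum_out_const -wE sumr_const -mulr_natl -/K sqrtrM ?(ltW K0) //.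
  by rewrite -[X in _ = _ * (_ * X)]mulrA; ring.
have p0 : 0 < 2 * K * w by rewrite !mulr_gt0.
have a_ge : Num.sqrt (K * w) <= a.
  have := ha (x 1); rewrite x_quad x_sqn mul1r expr1n mul1r.
  have -> : K * w + w * K = 2 * K * w by ring.
  by rewrite ler_pM2r.
have b_ge : Num.sqrt (K * w) <= b.
  have := hb (x (-1)); rewrite x_quad x_sqn mulN1r opprK sqrrN expr1n mul1r.
  have -> : K * w + w * K = 2 * K * w by ring.
  by rewrite ler_pM2r.
by rewrite mulr2n lerD.
Qed.

Lemma max_spread_lower (R : realType) n k (e : rel 'I_n) s : (0 < k < n)%N ->
  max_spread_minor_free R k.+2 e -> is_spread (adjmx R e) s ->
  Num.sqrt (k%:R * (n%:R - k%:R)) *+ 2 <= s.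
Proof.
move=> /andP[k0 kn] e_max es; have [L cL] := exists_set_of_card (ltnW kn).
pose e0 := join_indep L (fun _ _ => false).
have e0_simple : simple_graph e0 by apply: join_indep_simple; split.
have n0 := leq_ltn_trans (leq0n k) kn.
have [a [b [_ [_ [[_ _ ha] [_ _ hb] e0s]]]]] := spread_exists R n0 e0_simple.1.
have noK0 : ~ has_K_minor k.+2 e0 by rewrite -cL; exact: join_indep_minor_free.
have := e_max e0 e0_simple noK0 s _ es e0s; apply: le_trans.
by rewrite -cL; apply: (complete_bipartite_spread (L := L)) => //; rewrite cL k0.
Qed.

(** Caps both extreme eigenvalues near [sqrt (k n)]; with the lower bound on their sum, neither can
    be much smaller. *)
Lemma quad_bound_hubs (R : realType) n (e : rel 'I_n) (L : {set 'I_n}) (g : R) x :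
  symmetric e -> 0 <= g ->
  (forall x, `|quad_out L e x| <= g * \sum_(v in out_support e L) x v ^+ 2) ->
  sqn x = 1 ->
  `|quad (adj R e) x| <= Num.sqrt #|L|%:R * Num.sqrt n%:R + #|L|%:R + g.
Proof.
move=> e_sym g0 out_bound x1; rewrite (quad_parts L x e_sym).
have b1 := quad_in_bound L e x; rewrite x1 mulr1 in b1.
have b3 : `|quad_out L e x| <= g.
  apply: le_trans (out_bound x) _; rewrite ler_piMr // -x1 /sqn.
  rewrite [X in _ <= X](bigID (mem (out_support e L))) /= lerDl.
  by apply: sumr_ge0 => u _; exact: sqr_ge0.
have b2 : `|(\sum_(v | v \notin L) x v * hub_sum L e x v) *+ 2| <=
    Num.sqrt #|L|%:R * Num.sqrt n%:R.
  rewrite normrMn -(@ler_pXn2r _ 2) ?nnegrE ?mulrn_wge0 ?mulr_ge0 ?sqrtr_ge0 //.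
  rewrite exprMn_n real_normK ?num_real // exprMn !sqr_sqrtr ?ler0n //.
  have := cross_bound L e x; have := sqn_parts L x; rewrite x1.
  set A := \sum_(u in L) _; set B := \sum_(v | _) x v ^+ 2; set P := \sum_(v | _) _.
  have : 0 <= n%:R * #|L|%:R :> R by rewrite mulr_ge0 ?ler0n.
  rewrite [#|L|%:R * n%:R]mulrC -[_ * A * B]mulrA; move: (_ * #|L|%:R) => c c0 AB PP.
  have : A * B <= 1 / 4 by have := sqr_ge0 (A - B); nra.
  by move=> AB4; rewrite -mulr_natl; nra.
apply: le_trans (ler_normD _ _) _; apply: lerD => //.
apply: le_trans (ler_normD _ _) _; rewrite addrC; exact: lerD.
Qed.

Lemma hubs_numerics (R : realType) (k m n d G : nat) :
  (0 < d)%N -> (0 < G)%N -> (0 < k)%N -> (8 * d * G ^ 2 * m <= n)%N ->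
  (8 * d * G ^ 2 * (k + 3) ^ 2 <= n)%N ->
  exists t : R, [/\ 0 < t, t * d%:R + m.+1%:R / t <= G%:R^-1 * Num.sqrt n%:R,
    m%:R + k%:R <= G%:R^-1 ^+ 2 * Num.sqrt n%:R ^+ 2 :> R &
    k%:R <= G%:R^-1 * Num.sqrt n%:R :> R].
Proof.
move=> d0 G0 k0 hm hk; set nu : R := Num.sqrt n%:R; set gamma : R := G%:R^-1.
have n0 : (0 < n)%N by apply: leq_trans hk; rewrite !muln_gt0 ?expn_gt0 d0 G0 addn3.
have GR : 0 < G%:R :> R by rewrite ltr0n.
have dR : 1 <= d%:R :> R by rewrite ler1n.
have nu0 : 0 < nu by rewrite sqrtr_gt0 ltr0n.
have nu2 : nu ^+ 2 = n%:R by rewrite sqr_sqrtr // ler0n.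
have gamma0 : 0 < gamma by rewrite invr_gt0.
pose c : R := gamma ^+ 2 * nu ^+ 2.
have scale j : (8 * d * G ^ 2 * j <= n)%N -> 8 * d%:R * j%:R <= c.
  rewrite -(ler_nat R) !natrM -nu2 => le_n.
  rewrite /c /gamma exprVn [X in _ <= X]mulrC ler_pdivlMr ?exprn_gt0 //.
  by apply: le_trans le_n; rewrite le_eqVlt; apply/orP; left; apply/eqP; ring.
have cm := scale _ hm; have ck := scale _ hk.
have k1 : 1 <= k%:R :> R by rewrite ler1n.
have m1 : 0 <= m%:R :> R by rewrite ler0n.
rewrite natrX natrD in ck.
have c_d : 8 * d%:R <= c.
  by apply: le_trans ck; rewrite ler_peMr; nra.
have c_m : 8 * m%:R <= c.
  by apply: le_trans cm; rewrite ler_wpM2r //; lra.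
have c_k : 8 * (k%:R + 3) ^+ 2 <= c.
  by apply: le_trans ck; rewrite ler_wpM2r ?sqr_ge0 //; lra.
have gn0 : 0 < gamma * nu by rewrite mulr_gt0.
have cE : c = (gamma * nu) ^+ 2 by rewrite /c exprMn.
(* Then [t * d] is half the allowance [gamma * nu], and the size of [n] fits [(m + 1) / t] into the
   other half. *)
exists (gamma * nu / (2 * d%:R)); split.
- by rewrite divr_gt0 // mulr_gt0 //; lra.
- have -> : gamma * nu / (2 * d%:R) * d%:R + m.+1%:R / (gamma * nu / (2 * d%:R)) =
      gamma * nu / 2 + 2 * d%:R * m.+1%:R / (gamma * nu).
    by field; rewrite !gt_eqF //; lra.
  suff : 2 * d%:R * m.+1%:R / (gamma * nu) <= gamma * nu / 2 by lra.
  rewrite ler_pdivrMr //.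
  have -> : gamma * nu / 2 * (gamma * nu) = c / 2 by rewrite cE; field.
  by rewrite -[m.+1%:R]natr1; lra.
- by rewrite -/c; nra.
- rewrite -(@ler_pXn2r _ 2) ?nnegrE ?ler0n ?(ltW gn0) // -cE.
  by nra.
Qed.

(** If some vertex were unjoined, the same competitor [join_indep L e] would strictly raise the
    largest eigenvalue and lower the least, hence beat the maximal spread. *)
Lemma hub_structure (R : realType) n (e : rel 'I_n) (L : {set 'I_n}) d G :
  d = (2 ^ #|L|.+2)%N -> G = (300 * #|L| ^ 3)%N -> simple_graph e -> ~ has_K_minor #|L|.+2 e -> max_spread_minor_free R #|L|.+2 e ->
  (0 < #|L|)%N -> (8 * d * G ^ 2 * #|unjoined e L| <= n)%N ->
  (8 * d * G ^ 2 * (#|L| + 3) ^ 2 <= n)%N ->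
  unjoined e L = set0.
Proof.
move=> def_d def_G [e_sym e_irr] noK e_max L0 hm hk.
have G0 : (0 < G)%N by rewrite def_G muln_gt0 expn_gt0 L0.
have d0 : (0 < d)%N by rewrite def_d expn_gt0.
have dG : (8 <= 8 * d * G ^ 2)%N by rewrite -mulnA leq_pmulr // muln_gt0 d0 expn_gt0 G0.
have cardV : (#|L| + #|joined e L| + #|unjoined e L| = n)%N.
  have := cardsC (L :|: joined e L); rewrite card_ord cardsU.
  rewrite (_ : L :&: joined e L = set0) ?cards0 ?subn0 //.
  by apply/setP => v; rewrite !inE; case: (v \in L).
have m8 : (8 * #|unjoined e L| <= n)%N by apply: leq_trans hm; rewrite leq_mul2r dG orbT.
have k8 : (8 * (#|L| + 3) <= n)%N.
  apply: leq_trans hk; apply: leq_mul => //.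
  by rewrite expnS expn1 leq_pmulr // addn3.
have room : (#|L| + 3 <= #|joined e L|)%N by lia.
have kn : (#|L| < n)%N by lia.
have n0 : (0 < n)%N by lia.
have [t [t0 g_small m_small K_small]] := hubs_numerics R d0 G0 L0 hm hk.
move: g_small m_small K_small; set nu : R := Num.sqrt n%:R; set gamma : R := G%:R^-1.
move=> g_small m_small K_small.
have out_bound (x : 'I_n -> R) := quad_out_bound e_sym e_irr noK room x t0.
rewrite -def_d in out_bound.
set g := t * _ + _ in g_small out_bound.
have g0 : 0 <= g by rewrite /g; apply: addr_ge0; [apply: mulr_ge0|apply: divr_ge0]; rewrite ?ler0n ?(ltW t0).
have nu0 : 0 < nu by rewrite sqrtr_gt0 ltr0n.
have nu2 : nu ^+ 2 = n%:R by rewrite sqr_sqrtr // ler0n.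
have K1 : 1 <= #|L|%:R :> R by rewrite ler1n.
have gammaE : gamma * (300 * #|L|%:R ^+ 3) = 1.
  have -> : 300 * #|L|%:R ^+ 3 = G%:R :> R by rewrite def_G natrM natrX.
  by rewrite mulVf // gt_eqF // ltr0n.
have [a [b [y [z [[y1 ey ha] [z1 ez hb] es]]]]] := spread_exists R n0 e_sym.
have low := max_spread_lower (introT andP (conj L0 kn)) e_max es.
have low2 := sqrt_sub_ge R (ltnW kn); rewrite -/nu in low2.
have a_up : a <= Num.sqrt #|L|%:R * nu + #|L|%:R + g.
  apply: le_trans (quad_bound_hubs e_sym g0 out_bound y1).
  by apply: le_trans (ler_norm _); rewrite (quad_eigen ey) y1 mulr1.
have b_up : b <= Num.sqrt #|L|%:R * nu + #|L|%:R + g.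
  apply: le_trans (quad_bound_hubs e_sym g0 out_bound z1); rewrite -normrN.
  by apply: le_trans (ler_norm _); rewrite (quad_eigen ez) z1 mulr1 opprK.
(* The spread is at least [2 (sqrt K nu - K)]; subtracting the cap on [b] leaves
   [sqrt K nu - 3 K - g], and [K] and [g] are each at most [gamma nu]. *)
have a_big : Num.sqrt #|L|%:R * nu - 4 * gamma * nu <= a by rewrite mulr2n in low; lra.
have b_big : Num.sqrt #|L|%:R * nu - 4 * gamma * nu <= b by rewrite mulr2n in low; lra.
apply/eqP; rewrite -cards_eq0 -leqn0 leqNgt; apply/negP => m0.
have mR : 0 < #|unjoined e L|%:R :> R by rewrite ltr0n.
have ey' i : \sum_j adj R e i j * y j = 1 * a * y i by rewrite mul1r.
have ez' i : \sum_j adj R e i j * z j = -1 * b * z i by rewrite mulN1r.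
have one : 1 = 1 :> R \/ 1 = -1 :> R by left.
have mone : -1 = 1 :> R \/ -1 = -1 :> R by right.
have [x [x1 x_a]] := eigenvector_improved e_sym e_irr noK room K1 nu0 nu2 gammaE g0 g_small
  out_bound m_small K_small a_big one y1 ey' mR.
have [x' [x'1 x'_b]] := eigenvector_improved e_sym e_irr noK room K1 nu0 nu2 gammaE g0 g_small
  out_bound m_small K_small b_big mone z1 ez' mR.
have J_simple := join_indep_simple L (conj e_sym e_irr).
have [a' [b' [_ [_ [[_ _ ha'] [_ _ hb'] es']]]]] := spread_exists R n0 J_simple.1.
have := e_max _ J_simple (@join_indep_minor_free _ L e) _ _ es es'.
have := ha' x; have := hb' x'; rewrite x1 x'1 !mulr1.
by move: x_a x'_b; rewrite mul1r mulN1r; lra.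
Qed.

Theorem theorem3p8 (R : realType) (r : nat) : (3 <= r)%N ->
  exists N : nat, forall n : nat, (N <= n)%N ->
  forall e : rel 'I_n, simple_graph e -> ~ has_K_minor r e ->
    max_spread_minor_free R r e ->
    exists L : {set 'I_n},
      [/\ #|L| = (r - 2)%N,
          forall u v, u \in L -> v \notin L -> e u v &
          forall u v, u \notin L -> v \notin L -> ~~ e u v].
Proof.
case: r => [|[|k]] // k0; rewrite !subSS subn0; rewrite !ltnS in k0.
(* The factor [8 * d * G ^ 2] of [hub_structure], so that the bound from [exists_hubs] is its
   smallness hypothesis verbatim. *)
pose h := (8 * 2 ^ k.+2 * (300 * k ^ 3) ^ 2)%N.
have h1 : (1 < h)%N.
  have : (0 < 2 ^ k.+2 * (300 * k ^ 3) ^ 2)%N.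
    by rewrite muln_gt0 !expn_gt0 /= muln_gt0 expn_gt0 k0.
  by rewrite /h -mulnA; move: (2 ^ _ * _)%N => c; lia.
have [N0 N0P] := exists_hubs R k0 h1.
exists (N0 + h * (k + 3) ^ 2)%N => n leN e e_simple noK e_max.
have [e_sym e_irr] := e_simple.
have n_big : (2 * (k + 3) <= n)%N.
  apply: leq_trans leN; apply: leq_trans _ (leq_addl _ _); apply: leq_mul => //.
  by rewrite expnS expn1 leq_pmulr // addn3.
have kn : (k < n)%N by lia.
have n0 : (0 < n)%N by apply: leq_ltn_trans kn.
have [||L [cL mL]] := N0P n _ e e_simple noK; first exact: leq_trans (leq_addr _ _) leN.
  (* A bound [c] on the form dominates both [a] and [b], hence half the spread. *)
  move=> c hc; have [a [b [y [z [[y1 ey _] [z1 ez _] es]]]]] := spread_exists R n0 e_sym.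
  have := max_spread_lower (introT andP (conj k0 kn)) e_max es.
  have := hc y; have := hc z; rewrite y1 z1 (quad_eigen ey) (quad_eigen ez) y1 z1 !mulr1 normrN.
  by move: (ler_norm a) (ler_norm b); rewrite mulr2n; lra.
have U0 : unjoined e L = set0.
  apply: (@hub_structure R _ _ _ _ _ erefl erefl) => //; rewrite cL //.
  by apply: leq_trans leN; exact: leq_addl.
have joinedL v : v \notin L -> v \in joined e L.
  by move=> vL; have := notin_split e vL; rewrite U0 in_set0 orbF.
exists L; split=> // [u v uL vL|u v uL vL]; first exact: joinedP (joinedL v vL) uL.
have noKL : ~ has_K_minor #|L|.+2 e by rewrite cL.
apply: (joined_independent e_sym e_irr noKL); rewrite ?joinedL //.
rewrite cL; apply: (@leq_trans #|~: L|); last first.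
  by apply: subset_leq_card; apply/subsetP => x; rewrite inE; exact: joinedL.
by have := cardsC L; rewrite card_ord cL; lia.
Qed.
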